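(* Let $C_3$ be the triadic Cantor set with the regular ultrametric $d$ given in the context, let $\mu$ be its associated measure, let $s_0=\ln2/\ln3$, and for $s\in\mathbb R$ let $\Delta_s$ be the associated operator on $L^2(C_3,\mu)$. Then: (i) The eigenstates of $\Delta_s$ are given by the Haar functions $\phi_\omega$ with $\omega\in\mathcal W$. (ii) The eigenvalues of $\Delta_s$ are $-\lambda_n$, $n\ge0$, given by $\lambda_0=0$ and, for $n\ge1$, $$-\lambda_n=-2\Big(1+3^{s_0+2-s}+\cdots+(3^{s_0+2-s})^{n-2}+2(3^{s_0+2-s})^{n-1}\Big).$$ (iii) The degeneracy of $\lambda_n$ is $2^{n-1}$ for $n\ge1$, whereas $\lambda_0$ is simple. (iv) For $s>s_0+2$, $\Delta_s$ is bounded and is a compact perturbation of a multiple of the identity. (v) For $s\le s_0+2$, $\Delta_s$ has compact resolvent. (vi) For $s<s_0+2$, the density of states $\mathcal N(\lambda)$, given by the dimension of the spectral space corresponding to eigenvalues whose magnitude is less than or equal to $\lambda$, satisfies, as $\lambda\uparrow\infty$, $$\mathcal N(\lambda)\sim 2\Big(\frac{\lambda}{2k}\Big)^{s_0/(2+s_0-s)}(1+o(1)),\qquad\text{where } k=\frac{1}{1-3^{s-2-s_0}}+1.$$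
   Context: The triadic Cantor set $C_3\subset[0,1]$ is identified with $\{0,1\}^{\mathbb N}$ via $\omega=(\omega_i)_{i\ge 0}\mapsto\sum_{i\ge0}2\omega_i3^{-(i+1)}$; it is the boundary of the infinite rooted binary tree $\mathcal T_2$, whose vertex set $\mathcal V$ is the set of finite $0$-$1$ words (root = empty word, children of $v$ are $v0,v1$, height $\mathrm{ht}(v)$ = length of $v$). $[v]$ is the set of infinite sequences with prefix $v$ and $\chi_v$ its characteristic function. The regular ultrametric is $d(x,y)=3^{-m}$ for $x\ne y$, where $m$ is the length of the longest common prefix of $x,y$, so $\mathrm{diam}[v]=3^{-\mathrm{ht}(v)}$. A choice function is $\tau:\mathcal V\to C_3\times C_3$, $\tau(v)=(\tau_+(v),\tau_-(v))$ with $\tau_\pm(v)\in[v]$, $d(\tau_+(v),\tau_-(v))=\mathrm{diam}[v]$; $\Upsilon(C_3)$ is the set of choice functions, identified with $\prod_{v}\Upsilon_v$, $\Upsilon_v=([v0]\times[v1])\sqcup([v1]\times[v0])$. On $\ell^2(\mathcal V)\otimes\mathbb C^2$ let $(D\psi)(v)=(\mathrm{diam}[v])^{-1}\sigma_1\psi(v)$, $\sigma_1=\begin{pmatrix}0&1\\1&0\end{pmatrix}$, and $(\pi_\tau(f)\psi)(v)=\mathrm{diag}\{f(\tau_+(v)),f(\tau_-(v))\}\psi(v)$. The series $\mathrm{Tr}(|D|^{-s})$ has abscissa of convergence $s_0=\ln2/\ln3$. The associated probability measure $\mu(f)=\lim_{s\downarrow s_0}\mathrm{Tr}(|D|^{-s}\pi_\tau(f))/\mathrm{Tr}(|D|^{-s})$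 is the Borel measure on $C_3$ with $\mu([v])=2^{-\mathrm{ht}(v)}$. Let $\nu$ be the product measure on $\Upsilon(C_3)$ of the probability measures $\nu_v$ obtained by normalizing $\mu\times\mu$ on $\Upsilon_v$. For $s\in\mathbb R$ let $Q_s(f,g)=\frac12\int_{\Upsilon(C_3)}\mathrm{Tr}(|D|^{-s}[D,\pi_\tau(f)]^*[D,\pi_\tau(g)])\,d\nu(\tau)$ on the domain $\mathcal E$ = real linear span of $\{\chi_v:v\in\mathcal V\}$. This form is closable in the real Hilbert space $L^2(C_3,\mu)$, and $\Delta_s$ is the non-positive self-adjoint operator associated with its smallest closed extension, so that $\langle-\Delta_sf,g\rangle=Q_s(f,g)$ for $f,g\in\mathcal E$. $\mathcal W$ is the set of sequences $\omega=\omega_1\omega_2\cdots\in\{0,1\}^{\{1,2,\dots\}}$ with only finitely many nonzero entries; $|\omega|$ is the largest $k$ with $\omega_k=1$ ($|\omega|=0$ if $\omega=00\cdots$). The Haar function is $\phi_\omega=\sum_{v\in\{0,1\}^n}(-1)^{\omega\cdot v}\chi_v$, $\omega\cdot v=\sum_{k=1}^n\omega_kv_k$, for any $n\ge|\omega|$ (independent of $n$). The Haar functions form an orthonormal basis of $L^2(C_3,\mu)$.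
   Formalization: (iii): eigenspace degeneracy 2^{n-1} is claimed for s≠2+2s_0 (there all λ_n, n≥1, equal 4); for all s the level-n Haar span has that dimension. (vi): N/formula→1 only along eigenvalue magnitudes; for all real λ→∞ it lies in [1/2-o(1),1+o(1)], since N is a step function. *)

(* Defs.v *)
From HB Require Import structures.
From mathcomp Require Import all_boot all_order all_algebra.
From mathcomp Require Import complex.
From mathcomp Require Import all_classical all_reals all_analysis measurable_realfun.
Set Implicit Arguments.
Unset Strict Implicit.
Unset Printing Implicit Defensive.
Import Order.TTheory GRing.Theory Num.Theory.
Import numFieldNormedType.Exports.
Local Open Scope classical_set_scope.
Local Open Scope ring_scope.

(* The triadic Cantor set, [x] standing for the real number
   [\sum_i 2 x_i 3^-(i+1)], with its Borel sigma-algebra. *)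
Notation C3 := (g_sigma_algebraType (@open cantor_space)).

(* Vertices of the rooted binary tree; the height of [v] is [size v]. *)
Definition vertex := seq bool.

Definition cyl (v : vertex) : set C3 :=
  [set x : nat -> bool | mkseq x (size v) = v].

(* For [x <> y], the least index at which they differ is the length of their
   longest common prefix. *)
Definition dist (R : realType) (x y : nat -> bool) : R :=
  match pselect (exists n, x n != y n) with
  | left xy => 3 ^- ex_minn xy
  | right _ => 0
  end.

Definition vdiam (R : realType) (v : vertex) : R :=
  sup [set d | exists x y : C3, [/\ cyl v x, cyl v y & d = dist R x y]].

(* The word [v] followed by the sequence [t]. *)
Definition word_cat (v : vertex) (t : nat -> bool) : nat -> bool :=
  fun n => if (n < size v)%N then nth false v n else t (n - size v)%N.

Lemma cyl_word_cat v t : cyl v (word_cat v t).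
Proof.
apply: (@eq_from_nth _ false); rewrite size_mkseq// => i iv.
by rewrite nth_mkseq// /word_cat iv.
Qed.

Lemma cylP v (x : C3) :
  cyl v x <-> forall i, (i < size v)%N -> (x : nat -> bool) i = nth false v i.
Proof.
split=> [xv i iv|h].
  by rewrite -[in RHS]xv nth_mkseq.
apply: (@eq_from_nth _ false); rewrite size_mkseq// => i iv.
by rewrite nth_mkseq// h.
Qed.

Lemma dist_word_cat (R : realType) v (t u : nat -> bool) : t 0%N != u 0%N ->
  dist R (word_cat v t) (word_cat v u) = 3 ^- size v.
Proof.
move=> tu; rewrite /dist; case: pselect => [e|[]]; last first.
  by exists (size v); rewrite /word_cat ltnn subnn.
case: ex_minnP => m hm mmin; congr (3 ^- _).
apply/eqP; rewrite eqn_leq mmin ?andTb; last first.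
  by rewrite /word_cat ltnn subnn.
by rewrite leqNgt; apply: contra hm => mv; rewrite /word_cat mv.
Qed.

Lemma vdiamE (R : realType) v : vdiam R v = 3 ^- size v.
Proof.
set t0 := fun _ : nat => false; set t1 := fun _ : nat => true.
have ub x y : cyl v x -> cyl v y -> dist R x y <= 3 ^- size v.
  move=> /cylP xv /cylP yv; rewrite /dist; case: pselect => [e|_]; last first.
    by rewrite invr_ge0 exprn_ge0.
  case: ex_minnP => m hm _; rewrite lef_pV2 ?posrE ?exprn_gt0//.
  rewrite ler_weXn2l ?ler1n// leqNgt.
  by apply: contra hm => mv; rewrite xv// yv.
apply/eqP; rewrite eq_le; apply/andP; split.
  apply: ge_sup; first by exists (3 ^- size v), (word_cat v t0), (word_cat v t1);
    split; [exact: cyl_word_cat|exact: cyl_word_cat|rewrite dist_word_cat].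
  by move=> _ [x [y [xv yv ->]]]; exact: ub.
apply: ub_le_sup; first by exists (3 ^- size v) => _ [x [y [xv yv ->]]]; exact: ub.
exists (word_cat v t0), (word_cat v t1).
by split; [exact: cyl_word_cat|exact: cyl_word_cat|rewrite dist_word_cat].
Qed.

Lemma measurable_cyl v : measurable (cyl v).
Proof.
have -> : cyl v = \bigcap_(i in `I_(size v))
    (fun x : C3 => (x : cantor_space) i) @^-1` [set nth false v i].
  by apply/seteqP; split=> x; rewrite cylP.
apply: fin_bigcap_measurable => [|i _]; first exact: finite_II.
apply: sub_sigma_algebra.
apply: (@open_comp cantor_space bool); last exact: discrete_open.
by move=> x _; exact: (@proj_continuous nat (fun=> bool) i).
Qed.

Definition s0 (R : realType) : R := ln 2 / ln 3.

(* [(tau v).1] and [(tau v).2] are tau_+(v) and tau_-(v). *)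
Definition is_choice (R : realType) (tau : vertex -> C3 * C3) : Prop :=
  forall v, [/\ cyl v (tau v).1, cyl v (tau v).2 &
             dist R (tau v).1 (tau v).2 = vdiam R v].

Definition choice_fun (R : realType) : Type :=
  {tau : vertex -> C3 * C3 | is_choice R tau}.

Definition choice_fun0 (R : realType) : choice_fun R.
Proof.
exists (fun v => (word_cat v (fun=> false), word_cat v (fun=> true))) => v.
by split; [exact: cyl_word_cat|exact: cyl_word_cat|rewrite vdiamE dist_word_cat].
Defined.

HB.instance Definition _ (R : realType) := gen_eqMixin (choice_fun R).
HB.instance Definition _ (R : realType) := gen_choiceMixin (choice_fun R).
HB.instance Definition _ (R : realType) :=
  isPointed.Build (choice_fun R) (choice_fun0 R).

(* The product sigma-algebra: generated by the coordinates [tau |-> tau v]. *)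
Definition coord_sets (R : realType) : set (set (choice_fun R)) :=
  [set B | exists v (A : set (C3 * C3)),
     measurable A /\ B = [set tau | A (sval tau v)]].

Notation Upsilon R := (g_sigma_algebraType (@coord_sets R)).

Definition Upsilon_at (v : vertex) : set (C3 * C3) :=
  (cyl (rcons v false) `*` cyl (rcons v true)) `|`
  (cyl (rcons v true) `*` cyl (rcons v false)).

(* By uniqueness of measures on the pi-system of cylinders, this and
   [is_product_measure] below each characterize a single probability. *)
Definition is_cantor_measure (R : realType) (mu : probability C3 R) : Prop :=
  forall v, mu (cyl v) = (2 ^- size v)%:E.

Definition nu_at (R : realType) (mu : probability C3 R) (v : vertex)
    (A : set (C3 * C3)) : R :=
  fine ((mu \x mu) (A `&` Upsilon_at v)) / fine ((mu \x mu) (Upsilon_at v)).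

Definition is_product_measure (R : realType) (mu : probability C3 R)
    (nu : probability (Upsilon R) R) : Prop :=
  forall (F : seq vertex) (A : vertex -> set (C3 * C3)),
    uniq F -> (forall v, measurable (A v)) ->
    fine (nu [set tau | forall v, v \in F -> A v (sval tau v)]) =
    \prod_(v <- F) nu_at mu v (A v).

(* All the operators involved are block diagonal: [A : block_op R] stands for
   [(A psi)(v) = A v *m psi v], so that products, adjoints and real powers are
   computed block by block, on [l^2(vertex) (x) C^2]. *)
Definition block_op (R : realType) : Type := vertex -> 'M[R[i]]_2.

Section SpectralTriple.
Variable R : realType.
Implicit Types (A B : block_op R) (f g : C3 -> R) (tau : Upsilon R).

Definition sigma1 : 'M[R[i]]_2 := \matrix_(i, j) (i != j)%:R.

Definition dirac_op : block_op R := fun v => ((vdiam R v)^-1)%:C%C *: sigma1.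

(* [|D|^t]; the block of [D^* D] at [v] is the scalar [(diam [v])^-2]. *)
Definition absD_pow (t : R) : block_op R :=
  fun v => (((vdiam R v)^-1 `^ t)%:C%C)%:M.

Definition pi_rep tau f : block_op R := fun v =>
  diag_mx (\row_j (f (if j == ord0 then (sval tau v).1 else (sval tau v).2))%:C%C).

Definition bmul A B : block_op R := fun v => A v *m B v.
Definition badj A : block_op R := fun v => (map_mx Num.conj (A v))^T.
Definition bcomm A B : block_op R := fun v => A v *m B v - B v *m A v.

(* The trace is taken over [l^2(vertex) (x) C^2], summing by increasing height;
   in [Qform], only finitely many blocks are nonzero when [f] and [g] are
   combinations of indicators of cylinders, and the trace is real, as [f] and
   [g] are real. *)
Definition btrace A : R :=
  limn (fun N => \sum_(n < N) \sum_(v : n.-tuple bool) complex.Re (\tr (A v))).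

Definition Qform (nu : probability (Upsilon R) R) (s : R) f g : R :=
  2^-1 * \int[nu]_tau btrace
    (bmul (absD_pow (- s))
       (bmul (badj (bcomm dirac_op (pi_rep tau f)))
             (bcomm dirac_op (pi_rep tau g)))).

Lemma absD_powP v : absD_pow 2 v = bmul (badj dirac_op) dirac_op v.
Proof.
have d0 : 0 <= (vdiam R v)^-1 by rewrite vdiamE invrK exprn_ge0.
have cr (a : R) : Num.conj (a%:C%C) = a%:C%C by exact: conjc_real.
rewrite /absD_pow /bmul /badj /dirac_op powR_mulrn// expr2 rmorphM/=.
move: ((vdiam R v)^-1) => a; apply/matrixP => i j.
rewrite !mxE !big_ord_recl big_ord0 !mxE/= !rmorphM/= !cr !rmorph_nat.
by case: i => [[|[|//]] ?]; case: j => [[|[|//]] ?];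
  rewrite !eqE/= ?(mulr0n, mulr1n, mulr0, mul0r, mulr1, addr0, add0r).
Qed.

End SpectralTriple.

(* Elements of [L2 mu] are representatives, not classes: equality in the
   Hilbert space is [f = g %[ae mu]]. *)
Notation L2 mu := (LfunType mu (lee1n 2)).

Section HilbertL2.
Context (d : measure_display) (T : measurableType d) (R : realType).
Variable mu : {measure set T -> \bar R}.
Implicit Types (f g h : L2 mu) (S : set (L2 mu)).

Definition dotL2 f g : R := \int[mu]_x (f x * g x).
Definition normL2 f : R := Num.sqrt (dotL2 f f).
Definition cvgL2 (u : nat -> L2 mu) f : Prop :=
  (fun n => normL2 (u n - f)) @ \oo --> (0 : R).

Definition linear_span S : set (L2 mu) :=
  [set f | exists n (c : 'I_n -> R) (e : 'I_n -> L2 mu),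
     (forall i, S (e i)) /\ f = \sum_(i < n) c i *: e i].

Definition closed_span S : set (L2 mu) :=
  [set f | exists2 u : nat -> L2 mu,
     forall n, linear_span S (u n) & cvgL2 u f].

Definition has_dim S (n : nat) : Prop :=
  exists e : 'I_n -> L2 mu,
    [/\ forall i, S (e i),
        forall c : 'I_n -> R,
          \sum_(i < n) c i *: e i = 0 %[ae mu] -> forall i, c i = 0 &
        forall f, S f -> exists c : 'I_n -> R,
          f = \sum_(i < n) c i *: e i %[ae mu]].

Definition is_orthonormal_basis (I : Type) (e : I -> L2 mu) : Prop :=
  [/\ forall i, dotL2 (e i) (e i) = 1,
      forall i j, i <> j -> dotL2 (e i) (e j) = 0 &
      closed_span (range e) = [set: L2 mu]].

(* A possibly unbounded operator is given by its graph: [A f h] means that [f]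
   belongs to the domain of [A] and that [A f = h]. *)
Definition operator := L2 mu -> L2 mu -> Prop.
Implicit Type A : operator.

Definition op_sub_scalar A (z : R) : operator := fun f h => A f (h + z *: f).
Definition op_inv A : operator := fun f h => A h f.

Definition op_linear A : Prop := forall a f f' h h',
  A f h -> A f' h' -> A (a *: f + f') (a *: h + h').

Definition bounded_op A : Prop :=
  [/\ op_linear A, forall f, exists h, A f h &
      exists C : R, forall f h, A f h -> normL2 h <= C * normL2 f].

Definition compact_op A : Prop :=
  [/\ op_linear A, forall f, exists h, A f h &
      forall (u w : nat -> L2 mu) (C : R),
        (forall n, normL2 (u n) <= C) -> (forall n, A (u n) (w n)) ->
        exists (k : nat -> nat) h,
          {homo k : m n / (m < n)%N} /\ cvgL2 (w \o k) h].

Definition op_eigenspace A (a : R) : set (L2 mu) := [set f | A f (a *: f)].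
Definition op_eigenvector A (a : R) f : Prop :=
  op_eigenspace A a f /\ ~ (f = 0 %[ae mu]).
Definition op_eigenvalue A (a : R) : Prop := exists f, op_eigenvector A a f.

Definition spectral_space A (l : R) : set (L2 mu) :=
  closed_span [set f | exists2 a, `|a| <= l & op_eigenvector A a f].

Definition resolvent_set A (z : R) : Prop :=
  bounded_op (op_inv (op_sub_scalar A z)).
Definition compact_resolvent A : Prop :=
  (exists z, resolvent_set A z) /\
  forall z, resolvent_set A z -> compact_op (op_inv (op_sub_scalar A z)).

(* A nonnegative symmetric form is given by its domain [E] and by [q]; only the
   values of [q] on [E] are used. *)
Section Form.
Variables (E : set (L2 mu)) (q : L2 mu -> L2 mu -> R).

Definition form_approx f (u : nat -> L2 mu) : Prop :=
  [/\ forall n, E (u n), cvgL2 u f &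
      forall e : R, 0 < e -> exists N, forall m n, (N <= m)%N -> (N <= n)%N ->
        q (u m - u n) (u m - u n) < e].

(* The smallest closed extension of [(E, q)] (when the latter is closable). *)
Definition closure_dom : set (L2 mu) := [set f | exists u, form_approx f u].
Definition closure_val f g (c : R) : Prop :=
  exists u w, [/\ form_approx f u, form_approx g w &
                  (fun n => q (u n) (w n)) @ \oo --> c].

(* The non-positive operator [A] such that [<- A f, g>] is the value at [(f, g)]
   of the closure, for [f] in the domain of [A] and all [g] in that of the
   closure. *)
Definition form_operator : operator := fun f h =>
  closure_dom f /\ forall g, closure_dom g -> closure_val f g (- dotL2 h g).

End Form.
End HilbertL2.

Section Laplacian.
Variables (R : realType) (mu : probability C3 R) (nu : probability (Upsilon R) R).

Definition chi (v : vertex) : C3 -> R := \1_(cyl v).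

Definition form_dom : set (L2 mu) :=
  [set f | exists n (c : 'I_n -> R) (v : 'I_n -> vertex),
     forall x, f x = \sum_(i < n) c i * chi (v i) x].

Definition Delta (s : R) : operator mu :=
  form_operator form_dom (fun f g => Qform nu s f g).

End Laplacian.
Arguments Delta {R} mu nu s _ _.

(* The sequence omega_1 omega_2 ..., with omega_k = [sval w k.-1]. *)
Definition haar_index : Type :=
  {w : nat -> bool | exists N, forall k, (N <= k)%N -> w k = false}.

Lemma wlen_subproof (w : haar_index) :
  exists N, `[< forall k, (N <= k)%N -> sval w k = false >].
Proof. by have [N wN] := svalP w; exists N; apply/asboolP. Qed.

(* The largest [k] with [omega_k = 1], or [0]: with entries indexed from 0, the
   least [N] from which on [sval w] vanishes; see [wlenP]. *)
Definition wlen (w : haar_index) : nat := ex_minn (wlen_subproof w).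

Lemma wlenP (w : haar_index) :
  (0 < wlen w -> sval w (wlen w).-1)%N /\
  (forall k, (wlen w <= k)%N -> sval w k = false).
Proof.
rewrite /wlen; case: ex_minnP => m /asboolP wm mmin; split=> // m0.
apply/negPn/negP => wm1; have /mmin : `[< forall k, (m.-1 <= k)%N -> sval w k = false >].
  apply/asboolP => k; rewrite leq_eqVlt => /predU1P[<-|]; first exact/negbTE.
  by rewrite prednK//; exact: wm.
by rewrite leqNgt prednK// leqnn.
Qed.

Definition haar_fun (R : realType) (w : haar_index) : C3 -> R := fun x =>
  \sum_(v : (wlen w).-tuple bool)
    (-1) ^+ (\sum_(k < wlen w) sval w k * nth false v k)%N * chi R v x.

Lemma chi_Lfun (R : realType) (mu : probability C3 R) v :
  chi R v \in Lfun mu 2%:E.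
Proof.
have mchi : measurable_fun [set: C3] (chi R v).
  by apply/measurable_indicP; exact: measurable_cyl.
rewrite inE; apply/andP; split; rewrite inE//= /finite_norm unlock /Lnorm.
apply: poweR_lty; apply: (@le_lt_trans _ _ (\int[mu]_x (cst 1%E x))%E).
  apply: ge0_le_integral => //=.
  - apply/measurable_EFinP.
    apply: (@measurableT_comp _ _ _ _ _ _ (fun x : R => x `^ 2)) => //.
    exact: measurableT_comp.
  - move=> x _; rewrite lee_fin /chi indicE.
    by case: (x \in _); rewrite ?normr1 ?powR1// normr0 powR0.
by rewrite integral_cst// mul1e; apply: (le_lt_trans (probability_le1 mu measurableT)); exact: ltry.
Qed.

Lemma haar_Lfun (R : realType) (mu : probability C3 R) (w : haar_index) :
  haar_fun R w \in Lfun mu 2%:E.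
Proof.
have -> : haar_fun R w = \sum_(v : (wlen w).-tuple bool)
    (-1) ^+ (\sum_(k < wlen w) sval w k * nth false v k)%N *: chi R v.
  by apply/funext => x; rewrite fct_sumE.
have [L0 LD] := @Lfun_submod_closed _ _ _ mu _ (lee1n 2).
elim/big_rec: _ => // v f _ Lf; apply: LD => //; exact: chi_Lfun.
Qed.

Definition haar (R : realType) (mu : probability C3 R) (w : haar_index) : L2 mu :=
  Lfun_Sub (lee1n 2) (haar_Lfun mu w).

Definition ratio (R : realType) (s : R) : R := 3 `^ (s0 R + 2 - s).

Definition lam (R : realType) (s : R) (n : nat) : R :=
  if n is m.+1 then 2 * (\sum_(i < m) ratio s ^+ i + 2 * ratio s ^+ m) else 0.

(* The constant [k] of the asymptotics of the density of states. *)
Definition dos_const (R : realType) (s : R) : R :=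
  (1 - 3 `^ (s - 2 - s0 R))^-1 + 1.

Definition dos_asymptotics (R : realType) (s l : R) : R :=
  2 * (l / (2 * dos_const s)) `^ (s0 R / (2 + s0 R - s)).

(* Main.v *)
Require Import Defs.
From HB Require Import structures.
From mathcomp Require Import all_boot all_order all_algebra.
From mathcomp Require Import complex.
From mathcomp Require Import all_classical all_reals all_analysis measurable_realfun.
From mathcomp Require Import ring lra.
Set Implicit Arguments.
Unset Strict Implicit.
Unset Printing Implicit Defensive.
Import Order.TTheory GRing.Theory Num.Theory.
Import numFieldNormedType.Exports.
Local Open Scope classical_set_scope.
Local Open Scope ring_scope.

(** The form [Q_s] is diagonal in the Haar basis, and everything else is read
    off its eigenvalues.

    At a vertex [v] the commutator of [D] with [pi_tau f] is off-diagonal with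
    entries [+-(f (tau_+ v) - f (tau_- v)) / diam v], so the trace of the block is
    [2 diam^(s-2)] times the product of the jumps of [f] and [g] at [v]
    ([block_trace]). Under [nu] the points [tau_+ v] and [tau_- v] are independent
    and uniform, one on each half of the cylinder of [v]. Summing the expected
    products of jumps over the [2^k] vertices of height [k] gives
    [2^k (2 <f, g> - 4 <f, g>_k + 2 <f, g>_(k+1))], where [<f, g>_k] is the inner
    product of the projections to functions of the first [k] letters
    ([level_jump]). These projections are the partial sums of the Haar expansion:
    the Haar functions of length at most [k] are the characters of [(Z/2)^k], and
    orthogonality of characters ([sum_walsh]) converts the values on cylinders
    into coefficients. With [r = 2 * 3^(2-s)], a Haar function of length [n]
    therefore has energy [2 (1 + r + ... + r^(n-2) + 2 r^(n-1))]
    ([sum_levels_lam], [Qform_diag]).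

    The Haar functions are total because cylinders are a pi-system generating the
    Borel sets ([haar_total]), and square integrable functions form a complete
    space ([L2_complete]), so functions correspond to square summable families of
    coefficients ([combin_cvg]). A form [sum lam_i f_i g_i] on finite combinations
    is [<A f, A g>] with [A] the closed diagonal operator of the [sqrt lam_i]; its
    closure and its operator are thereby explicit, and the operator is diagonal
    with eigenvalues [- lam_i] ([form_operator_diag]).

    For a diagonal operator, eigenspaces and spectral spaces are described by the
    vanishing of coefficients, and it is compact when its eigenvalues tend to [0]
    along the degree, each degree having finitely many basis vectors
    ([diag_op_compact], by Tychonoff). If [r < 1] the eigenvalues converge, whence
    a compact perturbation of a scalar; if [r >= 1] they tend to infinity, whence
    a compact resolvent. Since [lam (n+2) - lam (n+1)] is
    [2 r^n (2 r - 1)], they are distinct unless [r = 1/2], that is [s = 2 + 2 s0].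

    If [r > 1], then [lam (n+1)] is [2 k r^n] up to a factor tending to [1], and
    [r^p = 2] for the exponent [p] of the density of states, while [2^(n+1)] Haar
    functions have length at most [n+1]. Hence the counting function is equivalent
    to the asymptotic formula at the eigenvalues, and stays constant until the
    next one, where the formula has doubled ([density_of_states]). *)

(** * The Hilbert space of square integrable functions *)

Section InnerProduct.
Context (d : measure_display) (T : measurableType d) (R : realType).
Variable mu : {measure set T -> \bar R}.
Implicit Types (f g h : L2 mu).

Lemma dotL2_integrable f g : mu.-integrable [set: T] (EFin \o (fun x => f x * g x)).
Proof.
apply/Lfun1_integrable; exact: (Lfun2_mul_Lfun1 (LfunP f) (LfunP g)).
Qed.

Lemma dotL2C f g : dotL2 f g = dotL2 g f.
Proof. by apply: eq_Rintegral => x _; rewrite mulrC. Qed.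

Lemma dotL2Dl f g h : dotL2 (f + g) h = dotL2 f h + dotL2 g h.
Proof.
rewrite /dotL2 -RintegralD//; [|exact: dotL2_integrable..].
by apply: eq_Rintegral => x _; rewrite mulrDl.
Qed.

Lemma dotL2Zl a f h : dotL2 (a *: f) h = a * dotL2 f h.
Proof.
rewrite /dotL2 -RintegralZl//; last exact: dotL2_integrable.
by apply: eq_Rintegral => x _; rewrite mulrA.
Qed.

Lemma dotL2Dr f g h : dotL2 h (f + g) = dotL2 h f + dotL2 h g.
Proof. by rewrite dotL2C dotL2Dl !(dotL2C _ h). Qed.

Lemma dotL2Zr a f h : dotL2 h (a *: f) = a * dotL2 h f.
Proof. by rewrite dotL2C dotL2Zl dotL2C. Qed.

Lemma dotL2Nl f h : dotL2 (- f) h = - dotL2 f h.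
Proof. by rewrite -scaleN1r dotL2Zl mulN1r. Qed.

Lemma dotL2Nr f h : dotL2 h (- f) = - dotL2 h f.
Proof. by rewrite dotL2C dotL2Nl dotL2C. Qed.

Lemma dotL2Bl f g h : dotL2 (f - g) h = dotL2 f h - dotL2 g h.
Proof. by rewrite dotL2Dl dotL2Nl. Qed.

Lemma dotL2Br f g h : dotL2 h (f - g) = dotL2 h f - dotL2 h g.
Proof. by rewrite dotL2Dr dotL2Nr. Qed.

Lemma dot0L2 f : dotL2 0 f = 0.
Proof. by rewrite -(scale0r f) dotL2Zl mul0r. Qed.

Lemma dotL20 f : dotL2 f 0 = 0.
Proof. by rewrite dotL2C dot0L2. Qed.

Lemma dotL2_suml (J : Type) (r : seq J) (F : J -> L2 mu) h :
  dotL2 (\sum_(i <- r) F i) h = \sum_(i <- r) dotL2 (F i) h.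
Proof.
elim: r => [|i r IH]; first by rewrite !big_nil dot0L2.
by rewrite !big_cons dotL2Dl IH.
Qed.

Lemma dotL2_sumr (J : Type) (r : seq J) (F : J -> L2 mu) h :
  dotL2 h (\sum_(i <- r) F i) = \sum_(i <- r) dotL2 h (F i).
Proof.
by rewrite dotL2C dotL2_suml; apply: eq_bigr => i _; rewrite dotL2C.
Qed.

Lemma dotL2_ge0 f : 0 <= dotL2 f f.
Proof. by apply: Rintegral_ge0 => x _; rewrite -expr2 sqr_ge0. Qed.

Lemma normL2_ge0 f : 0 <= normL2 f.
Proof. exact: sqrtr_ge0. Qed.

Lemma sqr_normL2 f : normL2 f ^+ 2 = dotL2 f f.
Proof. by rewrite sqr_sqrtr// dotL2_ge0. Qed.

Lemma normL20 : normL2 (0 : L2 mu) = 0.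
Proof. by rewrite /normL2 dotL20 sqrtr0. Qed.

(** If [<g, g> = 0] the form [a |-> <f + a g, f + a g>] is affine and
    nonnegative, hence constant; otherwise evaluate it at its minimum. *)
Lemma CauchySchwarzL2 f g : dotL2 f g ^+ 2 <= dotL2 f f * dotL2 g g.
Proof.
have pos a : 0 <= dotL2 f f + a * dotL2 f g * 2 + a ^+ 2 * dotL2 g g.
  have := dotL2_ge0 (f + a *: g).
  rewrite !(dotL2Dl, dotL2Dr, dotL2Zl, dotL2Zr) (dotL2C g f) => /le_trans; apply.
  by rewrite le_eqVlt; apply/predU1P; left; ring.
have := dotL2_ge0 g; rewrite le_eqVlt => /predU1P[g0|g0].
  have [fg0|fg0] := eqVneq (dotL2 f g) 0; first by rewrite fg0 -g0; nra.
  have := pos (- (dotL2 f f + 1) / (2 * dotL2 f g)); rewrite -g0.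
  rewrite (_ : _ + _ = -1); first lra.
  by field.
have := pos (- dotL2 f g / dotL2 g g).
rewrite (_ : _ + _ + _ = (dotL2 f f * dotL2 g g - dotL2 f g ^+ 2) / dotL2 g g).
  by rewrite pmulr_lge0 ?invr_gt0// subr_ge0.
by field; rewrite gt_eqF.
Qed.

Lemma le_dotL2_norm f g : `|dotL2 f g| <= normL2 f * normL2 g.
Proof.
rewrite -(@ler_pXn2r _ 2)// ?nnegrE ?mulr_ge0 ?normL2_ge0//.
by rewrite real_normK ?num_real// exprMn !sqr_normL2 CauchySchwarzL2.
Qed.

Lemma ler_normL2D f g : normL2 (f + g) <= normL2 f + normL2 g.
Proof.
rewrite -(@ler_pXn2r _ 2)// ?nnegrE ?addr_ge0 ?normL2_ge0//.
rewrite sqr_normL2 sqrrD !sqr_normL2 !(dotL2Dl, dotL2Dr) (dotL2C g f).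
have := le_trans (ler_norm _) (le_dotL2_norm f g); lra.
Qed.

Lemma normL2Z a f : normL2 (a *: f) = `|a| * normL2 f.
Proof.
by rewrite /normL2 dotL2Zl dotL2Zr mulrA sqrtrM -?expr2 ?sqr_ge0// sqrtr_sqr.
Qed.

Lemma normL2N f : normL2 (- f) = normL2 f.
Proof. by rewrite -scaleN1r normL2Z normrN1 mul1r. Qed.

Lemma normL2B f g : normL2 (f - g) = normL2 (g - f).
Proof. by rewrite -normL2N opprB. Qed.

Lemma normL2_eq0 f : normL2 f = 0 <-> f = 0 %[ae mu].
Proof.
have iff : mu.-integrable [set: T] (EFin \o (fun x => f x * f x)).
  exact: dotL2_integrable.
have mf : measurable_fun [set: T] (EFin \o (fun x => f x * f x)).
  exact: measurable_int iff.
split=> [/(congr1 (fun x => x ^+ 2))|f0].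
  rewrite sqr_normL2 expr0n/= => f0.
  have : (\int[mu]_x `|(f x * f x)%:E| = 0)%E.
    rewrite -[LHS]fineK//; last first.
      by rewrite ge0_fin_numE ?integral_ge0//; case/integrableP: iff.
    transitivity (dotL2 f f)%:E; last by rewrite f0.
    congr (fine _)%:E.
    by apply: eq_integral => x _; rewrite gee0_abs// lee_fin -expr2 sqr_ge0.
  move=> /ae_eq_integral_abs => /(_ measurableT mf).
  apply: filterS => x /(_ I)/= [] /eqP; rewrite mulf_eq0 orbb => /eqP fx _.
  by rewrite fx.
rewrite /normL2 /dotL2 /Rintegral (ae_eq_integral (cst 0%E))//.
- by rewrite integral0 sqrtr0.
- by apply: filterS f0 => x /(_ I) fx _/=; rewrite fx/= mulr0.
Qed.

Lemma cvgL2P (u : nat -> L2 mu) f : cvgL2 u f <->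
  forall e : R, 0 < e -> exists N, forall n, (N <= n)%N -> normL2 (u n - f) < e.
Proof.
split=> [/cvgrPdist_lt uf e /uf [N _ Nu]|uf].
  exists N => n /Nu; rewrite sub0r normrN ger0_norm//; exact: normL2_ge0.
apply/cvgrPdist_lt => e /uf [N Nu]; exists N => // n /Nu.
by rewrite sub0r normrN ger0_norm// normL2_ge0.
Qed.

Lemma cvgL2_dot (u w : nat -> L2 mu) f g : cvgL2 u f -> cvgL2 w g ->
  (fun n => dotL2 (u n) (w n)) @ \oo --> dotL2 f g.
Proof.
move=> uf wg; apply/subr_cvg0.
have lim0 : (fun n => normL2 (u n - f) * normL2 (w n - g) +
   normL2 (u n - f) * normL2 g + normL2 f * normL2 (w n - g)) @ \oo --> (0 : R).
  rewrite (_ : 0 = 0 * 0 + 0 * normL2 g + normL2 f * 0); last by rewrite !(mulr0, mul0r) !addr0.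
  apply: cvgD; first apply: cvgD.
  - exact: cvgM.
  - by apply: cvgM => //; exact: cvg_cst.
  - by apply: cvgM => //; exact: cvg_cst.
apply/norm_cvg0P; apply: (squeeze_cvgr _ (cvg_cst 0) lim0); near=> n.
rewrite normr_ge0/=.
rewrite (_ : _ - _ = dotL2 (u n - f) (w n - g) + dotL2 (u n - f) g + dotL2 f (w n - g)).
  apply: le_trans (ler_normD _ _) _; apply: lerD; last exact: le_dotL2_norm.
  apply: le_trans (ler_normD _ _) _; apply: lerD; exact: le_dotL2_norm.
rewrite !(dotL2Bl, dotL2Br); ring.
Unshelve. all: by end_near. Qed.

Lemma cvgL2_cst f : cvgL2 (fun=> f) f.
Proof. by rewrite /cvgL2 subrr normL20; exact: cvg_cst. Qed.

End InnerProduct.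

Section Completeness.
Context (d : measure_display) (T : measurableType d) (R : realType).
Variable mu : {measure set T -> \bar R}.
Implicit Types (f g h : L2 mu).

Lemma L2_sumE (J : Type) (r : seq J) (F : J -> L2 mu) x :
  (\sum_(i <- r) F i) x = \sum_(i <- r) F i x.
Proof. by elim: r => [|i r IH]; rewrite ?big_nil// !big_cons -IH. Qed.

(** The converse of [Lfun2_integrable_sqr]: a function is in [L^2] once its square
    has a finite integral. *)
Lemma Lfun2_sqr (f : T -> R) : measurable_fun [set: T] f ->
  (\int[mu]_x (f x ^+ 2)%:E < +oo)%E -> f \in Lfun mu 2%:E.
Proof.
move=> mf f2; rewrite inE; apply/andP; split; rewrite inE//= /finite_norm.
rewrite unlock /Lnorm; apply: poweR_lty; apply: le_lt_trans f2.
rewrite le_eqVlt; apply/predU1P; left; apply: eq_integral => x _.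
by rewrite /= powR_mulrn// real_normK// num_real.
Qed.

Lemma normr_Lfun2 f : Num.norm \o f \in Lfun mu 2%:E.
Proof.
apply: Lfun2_sqr; first exact: measurableT_comp.
have := Lfun2_integrable_sqr (LfunP f) => /integrableP[_]; apply: le_lt_trans.
rewrite le_eqVlt; apply/predU1P; left; apply: eq_integral => x _.
by rewrite /= real_normK ?num_real// ger0_norm// sqr_ge0.
Qed.

Definition absL2 f : L2 mu := Lfun_Sub (lee1n 2) (normr_Lfun2 f).

Lemma normL2_abs f : normL2 (absL2 f) = normL2 f.
Proof.
congr Num.sqrt; apply: eq_Rintegral => x _.
by rewrite /= -!expr2 real_normK// num_real.
Qed.

Lemma normL2_sum (J : Type) (r : seq J) (F : J -> L2 mu) :
  normL2 (\sum_(i <- r) F i) <= \sum_(i <- r) normL2 (F i).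
Proof.
elim: r => [|i r IH]; first by rewrite !big_nil normL20.
by rewrite !big_cons (le_trans (ler_normL2D _ _))// lerD2l.
Qed.

Lemma dotL2_EFin f : (dotL2 f f)%:E = (\int[mu]_x (f x ^+ 2)%:E)%E.
Proof.
rewrite /dotL2 /Rintegral fineK.
  by apply: eq_integral => x _; rewrite expr2.
by apply: integrable_fin_num => //; exact: dotL2_integrable.
Qed.

Lemma geometric_half n m :
  \sum_(n <= j < n + m) (2^-1 : R) ^+ j <= 2 * 2^-1 ^+ n.
Proof.
suff -> : \sum_(n <= j < n + m) (2^-1 : R) ^+ j = 2 * 2^-1 ^+ n - 2 * 2^-1 ^+ (n + m).
  by rewrite gerBl mulr_ge0// exprn_ge0// invr_ge0.
elim: m => [|m IH]; first by rewrite addn0 big_geq// subrr.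
rewrite addnS big_nat_recr ?leq_addr//= IH exprS; lra.
Qed.

Section Fast.
Variable v : nat -> L2 mu.
Hypothesis vfast : forall j, normL2 (v j.+1 - v j) <= 2^-1 ^+ j.

Lemma fast_dist m n : (m <= n)%N -> normL2 (v n - v m) <= 2 * 2^-1 ^+ m.
Proof.
move=> /subnKC <-; move: (n - m)%N => k; apply: le_trans (geometric_half m k).
elim: k => [|k IH]; first by rewrite addn0 subrr normL20 big_geq.
rewrite addnS big_nat_recr ?leq_addr//=.
rewrite (_ : _ - _ = (v (m + k).+1 - v (m + k)) + (v (m + k) - v m)); last first.
  by rewrite addrA subrK.
by rewrite (le_trans (ler_normL2D _ _))// addrC lerD.
Qed.

Let gap n : L2 mu := \sum_(0 <= j < n) absL2 (v j.+1 - v j).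

Let gapE n x : gap n x = \sum_(0 <= j < n) `|v j.+1 x - v j x|.
Proof. by rewrite /gap L2_sumE. Qed.

Let gap_ge0 n x : 0 <= gap n x.
Proof. by rewrite gapE sumr_ge0. Qed.

Let gap_homo x : {homo gap^~ x : m n / (m <= n)%N >-> m <= n}.
Proof.
apply: homo_leq => [//|? ? ?|n]; first exact: le_trans.
by rewrite !gapE big_nat_recr//= lerDl.
Qed.

Let gap_norm n : dotL2 (gap n) (gap n) <= 4.
Proof.
rewrite -sqr_normL2 (_ : 4 = 2 ^+ 2); last by rewrite -natrX.
rewrite lerXn2r ?nnegrE ?normL2_ge0//.
apply: le_trans (normL2_sum _ _) _.
have := geometric_half 0 n; rewrite add0n expr0 mulr1; apply: le_trans.
by apply: ler_sum_nat => j _; rewrite normL2_abs; exact: vfast.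
Qed.

(** By monotone convergence the increments of [v] are absolutely summable
    at almost every point. *)
Lemma fast_ae_cvg : {ae mu, forall x, cvgn (fun n => v n x)}.
Proof.
pose G n x := (gap n x ^+ 2)%:E.
have mG n : measurable_fun [set: T] (G n).
  by apply/measurable_EFinP; exact: measurable_funX.
have G0 n x : [set: T] x -> (0 <= G n x)%E by rewrite lee_fin sqr_ge0.
have ndG x : [set: T] x -> {homo G^~ x : m n / (m <= n)%N >-> (m <= n)%E}.
  by move=> _ m n mn; rewrite lee_fin lerXn2r ?nnegrE ?gap_ge0// gap_homo.
have cvgG x : cvgn (G^~ x) by apply: ereal_nondecreasing_is_cvgn; exact: ndG.
have intG : mu.-integrable [set: T] (fun x => limn (G^~ x)).
  apply/integrableP; split.
    by apply: (emeasurable_fun_cvg (fun n x => G n x)) => // x _; exact: cvgG.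
  rewrite (eq_integral (fun x => limn (G^~ x))); last first.
    move=> x _; rewrite gee0_abs//; apply: lime_ge => //.
    by apply: nearW => n; exact: G0.
  rewrite monotone_convergence//; apply: (@le_lt_trans _ _ 4%:E); last exact: ltry.
  apply: lime_le.
    apply: ereal_nondecreasing_is_cvgn => m n mn.
    by apply: ge0_le_integral => // x _; [exact: G0|exact: ndG].
  by apply: nearW => n; rewrite -dotL2_EFin lee_fin.
have := integrable_ae measurableT intG; apply: filterS => x /(_ I) Gfin.
have GE n : (G n x <= limn (G^~ x))%E.
  by apply: lime_ge => //; exists n => // m /= nm; exact: ndG.
have /normed_cvg : cvgn [normed (series (fun j => v j.+1 x - v j x))].
  apply: nondecreasing_is_cvgn.
    apply: nondecreasing_series => // j _ _; exact: normr_ge0.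
  exists (fine (limn (G^~ x)) + 1) => _ [n _ <-].
  have -> : [normed (series (fun j => v j.+1 x - v j x))] n = gap n x.
    by rewrite gapE.
  have := GE n; rewrite -[limn _]fineK// lee_fin.
  have := gap_ge0 n x; nra.
move=> cvgs; rewrite (_ : (fun n => v n x) =
    (fun n => v 0%N x + series (fun j => v j.+1 x - v j x) n)).
  by apply: is_cvgD => //; exact: is_cvg_cst.
by apply/funext => n; rewrite /series/= telescope_sumr// addrC subrK.
Qed.

(** By Fatou the almost everywhere limit is also the limit in norm. The upper
    limit is a measurable function that agrees with it wherever it exists. *)
Lemma fast_cvgL2 : exists f, cvgL2 v f.
Proof.
pose F x := fine (limn_esup (fun n => (v n x)%:E)).
have mF : measurable_fun [set: T] F.
  apply: measurableT_comp => //; apply: measurable_fun_limn_esup => n.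
  by apply/measurable_EFinP.
have Fcvg : {ae mu, forall x, v n x @[n --> \oo] --> F x}.
  have := fast_ae_cvg; apply: filterS => x vx.
  rewrite /F is_cvg_limn_esupE; last first.
    by apply/cvg_ex; exists (limn (v^~ x))%:E; apply/cvg_EFin => //; exact: nearW.
  rewrite (_ : limn _ = (limn (v^~ x))%:E)//; apply/cvg_lim => //.
  by apply/cvg_EFin => //; exact: nearW.
have Fdist m : (\int[mu]_x ((F x - v m x) ^+ 2)%:E <= ((2 * 2^-1 ^+ m) ^+ 2)%:E)%E.
  pose h n x := ((v n x - v m x) ^+ 2)%:E.
  have mh n : measurable_fun [set: T] (h n).
    by apply/measurable_EFinP; apply: measurable_funX; exact: measurable_funB.
  have h0 n x : [set: T] x -> (0 <= h n x)%E by rewrite lee_fin sqr_ge0.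
  have -> : (\int[mu]_x ((F x - v m x) ^+ 2)%:E = \int[mu]_x limn_einf (h^~ x))%E.
    apply: ae_eq_integral => //.
    - by apply/measurable_EFinP; apply: measurable_funX; exact: measurable_funB.
    - rewrite (_ : (fun x => _) = \- (fun x => limn_esup (fun n => - h n x)%E))%E; last first.
        apply/funext => x; rewrite -[LHS]oppeK; congr (- _)%E.
        exact/esym/(limn_esupN (h^~ x)).
      apply: measurableT_comp => //; apply: measurable_fun_limn_esup => n.
      exact: measurableT_comp.
    apply: filterS Fcvg => x vF _; apply/esym.
    have hx : h n x @[n --> \oo] --> ((F x - v m x) ^+ 2)%:E.
      apply/cvg_EFin; first exact: nearW.
      rewrite /comp/=; under eq_fun do rewrite expr2; rewrite expr2.
      by apply: cvgM; apply: cvgB => //; exact: cvg_cst.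
    by have [] := cvg_limn_einf_sup hx.
  apply: le_trans (fatou _ measurableT mh h0) _.
  rewrite limn_einf_lim; apply: lime_le; first exact: is_cvg_einfs.
  exists m => // n /= mn; apply: (@le_trans _ _ (\int[mu]_x h n x)%E).
    by apply: ereal_inf_lbound; exists n => //=.
  rewrite -(dotL2_EFin (v n - v m)) lee_fin -sqr_normL2.
  by rewrite lerXn2r ?nnegrE ?normL2_ge0 ?fast_dist// mulr_ge0// exprn_ge0// invr_ge0.
have FL : (fun x => F x - v 0%N x) \in Lfun mu 2%:E.
  apply: Lfun2_sqr; first exact: measurable_funB.
  by apply: le_lt_trans (Fdist 0%N) (ltry _).
exists (Lfun_Sub (lee1n 2) FL + v 0%N).
have lim0 : (fun m => 2 * 2^-1 ^+ m : R) @ \oo --> (0 : R).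
  rewrite -(mulr0 2); apply: cvgM; first exact: cvg_cst.
  by apply: cvg_expr; rewrite ger0_norm ?invr_ge0// invf_lt1// ltr1n.
apply: (squeeze_cvgr _ (cvg_cst 0) lim0); near=> m.
rewrite normL2_ge0/= normL2B -(@ler_pXn2r _ 2)// ?nnegrE ?normL2_ge0//.
rewrite sqr_normL2 -lee_fin; apply: le_trans (Fdist m); rewrite dotL2_EFin.
rewrite le_eqVlt; apply/predU1P; left; apply: eq_integral => x _.
by congr (_ ^+ 2)%:E; rewrite -[LHS]/(F x - v 0%N x + v 0%N x - v m x) subrK.
Unshelve. all: by end_near. Qed.

End Fast.

Definition cauchyL2 (u : nat -> L2 mu) := forall e : R, 0 < e ->
  exists N, forall m n, (N <= m)%N -> (N <= n)%N -> normL2 (u m - u n) < e.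

(** Riesz--Fischer: a Cauchy sequence converges to the limit of any of its rapidly
    converging subsequences. *)
Lemma L2_complete (u : nat -> L2 mu) : cauchyL2 u -> exists f, cvgL2 u f.
Proof.
move=> uC.
have /choice[N uN] : forall j, exists N, forall m n, (N <= m)%N -> (N <= n)%N ->
    normL2 (u m - u n) < 2^-1 ^+ j.
  by move=> j; apply: uC; rewrite exprn_gt0// invr_gt0.
(* Partial sums dominate both [N j] and [j] and are increasing in [j]. *)
pose k j := (\sum_(0 <= i < j.+1) (N i).+1)%N.
have kN j : (N j <= k j)%N by rewrite /k big_nat_recr//= (leq_trans (leqnSn _)) ?leq_addl.
have kS j : (k j <= k j.+1)%N by rewrite [k j.+1]big_nat_recr//= leq_addr.
have [f vf] : exists f, cvgL2 (u \o k) f.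
  apply: fast_cvgL2 => j; apply/ltW/uN => //.
  exact: leq_trans (kN j) (kS j).
exists f; apply/cvgL2P => e e0.
have e2 : 0 < e / 2 by rewrite divr_gt0.
have [M uM] := uC _ e2; have [M' vM'] := (cvgL2P _ _).1 vf _ e2.
have kK j : (j <= k j)%N.
  by elim: j => // j IH; rewrite /k big_nat_recr//= addnS ltnS (leq_trans IH)// leq_addr.
pose K := maxn M M'.
have MK : (M <= k K)%N by rewrite (leq_trans _ (kK K))// leq_maxl.
exists M => n Mn; rewrite (_ : u n - f = (u n - u (k K)) + (u (k K) - f)); last first.
  by rewrite addrA subrK.
rewrite (splitr e); apply: le_lt_trans (ler_normL2D _ _) _.
by apply: ltrD; [exact: uM|apply: vM'; exact: leq_maxr].
Qed.

End Completeness.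

(** * Graded orthonormal bases and diagonal operators *)

Section Span.
Context (d : measure_display) (T : measurableType d) (R : realType).
Variable mu : {measure set T -> \bar R}.
Implicit Types (f g h : L2 mu) (S : set (L2 mu)).

(** Terms with a zero coefficient are dropped, so a truncated expansion lies in the
    span of those basis vectors that it really involves. *)
Lemma linear_span_big S (J : Type) (r : seq J) (c : J -> R) (F : J -> L2 mu) :
  (forall j, c j != 0 -> S (F j)) -> linear_span S (\sum_(j <- r) c j *: F j).
Proof.
move=> SF.
elim: r => [|j r [n [c' [e' [Se' IH]]]]].
  by exists 0%N, (fun=> 0), (fun=> 0); split; [case|rewrite big_nil big_ord0].
rewrite big_cons IH; have [cj0|cj0] := eqVneq (c j) 0.
  by exists n, c', e'; split=> //; rewrite cj0 scale0r add0r.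
exists n.+1, (fun i => if unlift ord0 i is Some k then c' k else c j),
  (fun i => if unlift ord0 i is Some k then e' k else F j); split.
  by move=> i; case: unliftP => [k|] _ //; exact: SF.
rewrite big_ord_recl unlift_none; congr (_ + _).
by apply: eq_bigr => i _; rewrite liftK.
Qed.

Lemma closed_span_lim S (u : nat -> L2 mu) f :
  (forall n, linear_span S (u n)) -> cvgL2 u f -> closed_span S f.
Proof. by move=> Su uf; exists u. Qed.

End Span.

Section GradedBasis.
Context (d : measure_display) (T : measurableType d) (R : realType).
Variable mu : {measure set T -> \bar R}.
Implicit Types (f g h : L2 mu).

Variables (I : eqType) (e : I -> L2 mu) (deg : I -> nat) (L : nat -> seq I).

(** A total orthonormal family whose members of degree at most [n] are listed by
    [L n]: sums over the finite levels replace sums over the index type. *)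
Record graded_basis : Prop := GradedBasis {
  graded_orth : forall i j, dotL2 (e i) (e j) = (i == j)%:R;
  graded_uniq : forall n, uniq (L n);
  graded_mem : forall n i, (i \in L n) = (deg i <= n)%N;
  graded_total : forall f, (forall i, dotL2 f (e i) = 0) -> normL2 f = 0
}.

Hypothesis basis : graded_basis.

Let e_orth i j : dotL2 (e i) (e j) = (i == j)%:R.
Proof. exact: graded_orth. Qed.

Let L_uniq n : uniq (L n). Proof. exact: graded_uniq. Qed.

Let mem_L n i : (i \in L n) = (deg i <= n)%N. Proof. exact: graded_mem. Qed.

Let e_total f : (forall i, dotL2 f (e i) = 0) -> normL2 f = 0.
Proof. exact: graded_total. Qed.

Definition coef f i := dotL2 f (e i).
Definition combin (c : I -> R) n : L2 mu := \sum_(i <- L n) c i *: e i.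
Definition cutoff n f := combin (coef f) n.

Lemma coefL2D f g i : coef (f + g) i = coef f i + coef g i.
Proof. exact: dotL2Dl. Qed.
Lemma coefL2B f g i : coef (f - g) i = coef f i - coef g i.
Proof. exact: dotL2Bl. Qed.
Lemma coefL2Z a f i : coef (a *: f) i = a * coef f i.
Proof. exact: dotL2Zl. Qed.

Lemma coef_basis i j : coef (e i) j = (i == j)%:R.
Proof. exact: e_orth. Qed.

Lemma sum_delta n (F : I -> R) j :
  \sum_(i <- L n) F i * (i == j)%:R = if (deg j <= n)%N then F j else 0.
Proof.
case: ifP => jn.
  rewrite (bigD1_seq j) ?mem_L//= eqxx mulr1 big1 ?addr0// => i /negbTE ->.
  by rewrite mulr0.
rewrite big_seq big1// => i; rewrite mem_L => iN.
by case: eqP => [ij|]; rewrite ?mulr0//; move: iN; rewrite ij jn.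
Qed.

Lemma coef_combin c n i : coef (combin c n) i = if (deg i <= n)%N then c i else 0.
Proof.
rewrite /coef dotL2_suml -sum_delta; apply: eq_bigr => j _.
by rewrite dotL2Zl e_orth.
Qed.

Lemma dot_combin c n f : dotL2 (combin c n) f = \sum_(i <- L n) c i * coef f i.
Proof.
by rewrite dotL2_suml; apply: eq_bigr => i _; rewrite dotL2Zl dotL2C.
Qed.

Lemma big_LE n (F : I -> R) (G : I -> R) :
  (forall i, (deg i <= n)%N -> F i = G i) ->
  \sum_(i <- L n) F i = \sum_(i <- L n) G i.
Proof.
move=> FG; rewrite big_seq [RHS]big_seq; apply: eq_bigr => i.
by rewrite mem_L; exact: FG.
Qed.

Lemma big_L_widen (V : nmodType) m n (F : I -> V) : (m <= n)%N ->
  \sum_(i <- L m) F i = \sum_(i <- L n | (deg i <= m)%N) F i.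
Proof.
move=> mn; rewrite -[RHS]big_filter; apply: perm_big; apply: uniq_perm.
- exact: L_uniq.
- by rewrite filter_uniq.
- by move=> i; rewrite mem_filter !mem_L; case: leqP => // /leq_trans ->.
Qed.

Lemma dot_combin2 c c' n :
  dotL2 (combin c n) (combin c' n) = \sum_(i <- L n) c i * c' i.
Proof. by rewrite dot_combin; apply: big_LE => i iN; rewrite coef_combin iN. Qed.

Lemma dot_combin_sqr c n : dotL2 (combin c n) (combin c n) = \sum_(i <- L n) c i ^+ 2.
Proof. by rewrite dot_combin2; apply: eq_bigr => i _; rewrite expr2. Qed.

Lemma coef_cutoff n f i : coef (cutoff n f) i = if (deg i <= n)%N then coef f i else 0.
Proof. exact: coef_combin. Qed.

Lemma Bessel n f : \sum_(i <- L n) coef f i ^+ 2 <= dotL2 f f.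
Proof.
have := dotL2_ge0 (f - cutoff n f).
rewrite dotL2Bl !dotL2Br (dotL2C f) dot_combin -dot_combin2 subrr subr0.
by rewrite dot_combin_sqr subr_ge0.
Qed.

Lemma normL2_combin c n (B : R) : 0 <= B ->
  \sum_(i <- L n) c i ^+ 2 <= B ^+ 2 -> normL2 (combin c n) <= B.
Proof.
move=> B0 cB; rewrite -(@ler_pXn2r _ 2)// ?nnegrE ?normL2_ge0//.
by rewrite sqr_normL2 dot_combin_sqr.
Qed.

Lemma dot_combinB c m n : (m <= n)%N ->
  dotL2 (combin c n - combin c m) (combin c n - combin c m) =
  \sum_(i <- L n) c i ^+ 2 - \sum_(i <- L m) c i ^+ 2.
Proof.
move=> mn; have cross : dotL2 (combin c m) (combin c n) = \sum_(i <- L m) c i ^+ 2.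
  rewrite dot_combin; apply: big_LE => i im.
  by rewrite coef_combin (leq_trans im mn) expr2.
rewrite !(dotL2Bl, dotL2Br) (dotL2C (combin c n) (combin c m)) cross.
by rewrite !dot_combin_sqr subrr subr0.
Qed.

Lemma L_sum_homo (F : I -> R) : (forall i, 0 <= F i) ->
  {homo (fun n => \sum_(i <- L n) F i) : m n / (m <= n)%N >-> m <= n}.
Proof.
move=> F0 m n mn; rewrite (big_L_widen _ mn).
by rewrite big_mkcond; apply: ler_sum => i _; case: ifP.
Qed.

(** The partial sums form a Cauchy sequence because the sums of squares over the
    levels are nondecreasing and bounded. *)
Lemma combin_cvg (c : I -> R) (B : R) :
  (forall n, \sum_(i <- L n) c i ^+ 2 <= B) ->
  exists h, (forall i, coef h i = c i) /\ cvgL2 (combin c) h.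
Proof.
move=> cB; pose S n := \sum_(i <- L n) c i ^+ 2.
have ndS : nondecreasing_seq S.
  by apply: (@L_sum_homo (fun i => c i ^+ 2)) => i; exact: sqr_ge0.
have cvgS : cvgn S.
  by apply: nondecreasing_is_cvgn => //; exists B => _ [n _ <-]; exact: cB.
have /L2_complete[h ch] : cauchyL2 (combin c).
  move=> r r0; have r2 : 0 < r ^+ 2 by rewrite exprn_gt0.
  have /cvgrPdist_lt/(_ _ r2)[N _ SN] := cvgS.
  have close m n : (N <= m)%N -> (m <= n)%N -> normL2 (combin c n - combin c m) < r.
    move=> Nm mn; rewrite -(@ltr_pXn2r _ 2)// ?nnegrE ?normL2_ge0 ?ltW//.
    rewrite sqr_normL2 dot_combinB//; apply: le_lt_trans (SN m Nm).
    apply: le_trans (ler_norm _); rewrite lerB//.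
    exact: nondecreasing_cvgn_le.
  exists N => m n Nm Nn; have [mn|/ltnW nm] := leqP m n; last exact: close.
  by rewrite normL2B; exact: close.
exists h; split=> // i.
have := cvgL2_dot ch (cvgL2_cst (e i)) => /cvg_lim; rewrite -/(coef h i) => <- //.
apply/cvg_lim => //; apply: cvg_near_cst; exists (deg i) => // n /= iN.
by have := coef_combin c n i; rewrite /coef iN.
Qed.

Lemma coef_inj f g : (forall i, coef f i = coef g i) -> normL2 (f - g) = 0.
Proof. by move=> fg; apply: e_total => i; rewrite -/(coef _ _) coefL2B fg subrr. Qed.

Lemma L2_ae_eqP f g : f = g %[ae mu] <-> normL2 (f - g) = 0.
Proof.
rewrite normL2_eq0; split; apply: filterS => x fg /fg.
  by move=> fgx; rewrite -[LHS]/(f x - g x) fgx subrr.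
by move/eqP; rewrite -[X in X == _]/(f x - g x) subr_eq0 => /eqP.
Qed.

Lemma coef_ae_eqP f g : f = g %[ae mu] <-> forall i, coef f i = coef g i.
Proof.
rewrite L2_ae_eqP; split; last exact: coef_inj.
move=> fg i; apply/eqP; rewrite -subr_eq0 -coefL2B -normr_le0.
by apply: le_trans (le_dotL2_norm _ _) _; rewrite fg mul0r.
Qed.

(** The expansion converges to a function with the same coefficients as [f], which
    totality identifies with [f]. *)
Lemma cutoff_cvg f : cvgL2 (cutoff^~ f) f.
Proof.
have [h [hc ch]] := combin_cvg (Bessel^~ f).
have hf : normL2 (h - f) = 0 by exact: coef_inj.
apply: (squeeze_cvgr _ (cvg_cst 0) ch); near=> n.
rewrite normL2_ge0/= -[leRHS]addr0 -hf; apply: le_trans (ler_normL2D _ _).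
by rewrite addrA subrK.
Unshelve. all: by end_near. Qed.

Lemma Parseval f g :
  (fun n => \sum_(i <- L n) coef f i * coef g i) @ \oo --> dotL2 f g.
Proof.
have := cvgL2_dot (cutoff_cvg f) (cvgL2_cst g).
by under eq_fun do rewrite dot_combin.
Qed.

Lemma Bessel_le f (C : R) : 0 <= C ->
  (forall n, \sum_(i <- L n) coef f i ^+ 2 <= C ^+ 2) -> normL2 f <= C.
Proof.
move=> C0 fC; rewrite -(@ler_pXn2r _ 2)// ?nnegrE ?normL2_ge0// sqr_normL2.
have fP := @Parseval f f; have /cvg_lim <- // := fP.
apply: limr_le; first by apply/cvg_ex; eexists; exact: fP.
by apply: nearW => n; under eq_bigr do rewrite -expr2.
Qed.

Lemma coef_cvg (u : nat -> L2 mu) f i : cvgL2 u f ->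
  (fun n => coef (u n) i) @ \oo --> coef f i.
Proof. by move=> uf; exact: cvgL2_dot (cvgL2_cst _). Qed.

Lemma coefL2_sum (J : Type) (r : seq J) (F : J -> L2 mu) i :
  coef (\sum_(j <- r) F j) i = \sum_(j <- r) coef (F j) i.
Proof. exact: dotL2_suml. Qed.

Lemma closed_span_coef0 (S : set (L2 mu)) f i :
  (forall g, S g -> coef g i = 0) -> closed_span S f -> coef f i = 0.
Proof.
move=> S0 [u Su uf]; have := coef_cvg (i := i) uf => /cvg_lim <- //.
rewrite (_ : (fun n => _) = fun=> 0) ?lim_cst//; apply/funext => n.
have [m [c [w [Sw ->]]]] := Su n.
by rewrite coefL2_sum big1// => k _; rewrite coefL2Z S0 ?mulr0.
Qed.

(** One inclusion holds because coefficients are continuous, the other because the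
    cutoffs of [f] involve only basis vectors with a nonzero coefficient. *)
Lemma closed_span_coefP (S : set (L2 mu)) (P : I -> Prop) :
  (forall i, P i -> S (e i)) ->
  (forall g i, S g -> ~ P i -> coef g i = 0) ->
  closed_span S = [set f | forall i, ~ P i -> coef f i = 0].
Proof.
move=> PS SP; apply/seteqP; split=> f.
  by move=> Sf i nPi; apply: closed_span_coef0 Sf => g Sg; exact: SP.
move=> fP; apply: closed_span_lim (cutoff_cvg f) => n.
apply: linear_span_big => i; apply: contra_neqP => nS.
by apply: fP => Pi; apply: nS; exact: PS.
Qed.

(** A function is determined almost everywhere by its coefficients; this reduces
    all the dimension counts below to counting basis vectors. *)
Lemma has_dim_coef (J : finType) (n : nat) (iota : J -> I) (S : set (L2 mu)) :
  #|J| = n -> injective iota -> (forall j, S (e (iota j))) ->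
  (forall f i, S f -> (forall j, i <> iota j) -> coef f i = 0) ->
  has_dim S n.
Proof.
move=> <- inj Se S0; exists (fun k => e (iota (enum_val k))).
have coefE (c : 'I_#|J| -> R) k :
    coef (\sum_(i < #|J|) c i *: e (iota (enum_val i))) (iota (enum_val k)) = c k.
  rewrite coefL2_sum (bigD1 k)//= coefL2Z coef_basis eqxx mulr1 big1 ?addr0// => j jk.
  rewrite coefL2Z coef_basis (inj_eq inj) (inj_eq enum_val_inj) (negbTE jk).
  by rewrite mulr0.
split=> //.
  by move=> c c0 k; rewrite -(coefE c) (coef_ae_eqP _ 0).1// /coef dot0L2.
move=> f Sf; exists (fun k => coef f (iota (enum_val k))).
apply/coef_ae_eqP => i.
have [[j ->]|ni] := pselect (exists j, i = iota j).
  by rewrite -(enum_rankK j) coefE.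
rewrite S0//; last by move=> j ij; apply: ni; exists j.
rewrite coefL2_sum big1// => k _; rewrite coefL2Z coef_basis.
by case: eqP => [ik|]; rewrite ?mulr0//; case: ni; exists (enum_val k).
Qed.

(** ** Diagonal operators *)

(** The domain consists of the [f] for which the family [k i * coef f i] is square
    summable, since only then does some [h] have these coefficients. *)
Definition diag_op (k : I -> R) : operator mu :=
  fun f h => forall i, coef h i = k i * coef f i.

Lemma diag_op_shift k z :
  op_sub_scalar (diag_op k) z = diag_op (fun i => k i - z).
Proof.
apply/funext => f; apply/funext => h; apply/propext; split=> H i; have := H i;
  rewrite coefL2D coefL2Z mulrBl.
  by move=> <-; rewrite addrK.
by move=> ->; rewrite subrK.
Qed.

Lemma diag_op_inv k : (forall i, k i != 0) ->
  op_inv (diag_op k) = diag_op (fun i => (k i)^-1).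
Proof.
move=> k0; apply/funext => f; apply/funext => h; apply/propext.
by split=> H i; rewrite (H i) ?mulKf ?mulVKf.
Qed.

Lemma diag_op_linear k : op_linear (diag_op k).
Proof.
by move=> a f f' h h' fh fh' i; rewrite !coefL2D !coefL2Z fh fh'; ring.
Qed.

Lemma diag_op_total k (C : R) f : (forall i, `|k i| <= C) -> exists h, diag_op k f h.
Proof.
move=> kC; have [|h [hc _]] := @combin_cvg (fun i => k i * coef f i) (C ^+ 2 * dotL2 f f).
  move=> n; apply: le_trans (ler_wpM2l (sqr_ge0 C) (Bessel n f)).
  rewrite mulr_sumr; apply: ler_sum => i _.
  rewrite exprMn ler_wpM2r ?sqr_ge0// -(real_normK (num_real (k i))).
  by rewrite lerXn2r// ?nnegrE// (le_trans _ (kC i)).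
by exists h.
Qed.

Lemma diag_op_norm k (C : R) f h : 0 <= C -> (forall i, `|k i| <= C) ->
  diag_op k f h -> normL2 h <= C * normL2 f.
Proof.
move=> C0 kC fh; apply: Bessel_le; first by rewrite mulr_ge0 ?normL2_ge0.
move=> n; rewrite exprMn sqr_normL2.
apply: le_trans (ler_wpM2l (sqr_ge0 C) (Bessel n f)).
rewrite mulr_sumr; apply: ler_sum => i _; rewrite fh.
rewrite exprMn ler_wpM2r ?sqr_ge0// -(real_normK (num_real (k i))).
by rewrite lerXn2r// nnegrE.
Qed.

Lemma diag_op_bounded k (C : R) : (forall i, `|k i| <= C) -> bounded_op (diag_op k).
Proof.
move=> kC; split; first exact: diag_op_linear.
  by move=> f; exact: diag_op_total kC.
exists `|C| => f h; apply: diag_op_norm => // i.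
exact: le_trans (kC i) (ler_norm C).
Qed.

Lemma dot_basis_neq0 i : ~ normL2 (e i) = 0.
Proof.
move/(congr1 (fun x => x ^+ 2)); rewrite sqr_normL2 e_orth eqxx expr0n/=.
by move/eqP; rewrite oner_eq0.
Qed.

(** If [k i = 0], the inverse relation sends [0] to [e i], against the norm bound. *)
Lemma diag_op_inv_neq0 k : bounded_op (op_inv (diag_op k)) -> forall i, k i != 0.
Proof.
move=> [_ _ [C bC]] i; apply/eqP => ki0.
have : op_inv (diag_op k) 0 (e i).
  move=> j; rewrite coef_basis /coef dot0L2; case: eqP => [<-|_].
    by rewrite ki0 mul0r.
  by rewrite mulr0.
move/bC; rewrite normL20 mulr0 => ei0; apply: (@dot_basis_neq0 i).
by apply/eqP; rewrite eq_le ei0 normL2_ge0.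
Qed.

Lemma diag_eigenspaceP k a :
  op_eigenspace (diag_op k) a = [set f | forall i, k i <> a -> coef f i = 0].
Proof.
apply/seteqP; split=> f.
  move=> fa i /eqP; rewrite eq_sym => ki; have /eqP := fa i.
  by rewrite coefL2Z -subr_eq0 -mulrBl mulf_eq0 subr_eq0 (negbTE ki) => /eqP.
move=> f0 i; rewrite coefL2Z; have [->//|/eqP ki] := eqVneq (k i) a.
by rewrite f0// !mulr0.
Qed.

Lemma diag_eigenvector_basis k a i : op_eigenvector (diag_op k) a (e i) <-> k i = a.
Proof.
rewrite /op_eigenvector diag_eigenspaceP; split.
  move=> [ei0 _]; apply/eqP/negPn/negP => /eqP/ei0.
  by rewrite coef_basis eqxx => /eqP; rewrite oner_eq0.
move=> <-; split; last by move/normL2_eq0; exact: dot_basis_neq0.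
by move=> j kj; rewrite coef_basis; case: eqP => // ij; case: kj; rewrite ij.
Qed.

Lemma diag_eigenvalueP k a : op_eigenvalue (diag_op k) a <-> exists i, k i = a.
Proof.
split=> [[f []]|[i <-]]; last by exists (e i); apply/diag_eigenvector_basis.
rewrite diag_eigenspaceP => fa f0; apply: contrapT => na; apply: f0.
by apply/(coef_ae_eqP _ 0) => i; rewrite fa /coef ?dot0L2// => ki; apply: na; exists i.
Qed.

Lemma diag_eigenspace_span k a : op_eigenspace (diag_op k) a =
  closed_span [set e i | i in [set i | op_eigenvector (diag_op k) a (e i)]].
Proof.
rewrite (@closed_span_coefP _ (fun i => k i = a)) ?diag_eigenspaceP//.
  by move=> i ki; exists i => //; apply/diag_eigenvector_basis.
move=> _ i [j /diag_eigenvector_basis kj <-] ki.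
by rewrite coef_basis; case: eqP => // ji; case: ki; rewrite -ji.
Qed.

Lemma diag_spectral_spaceP k l : spectral_space (diag_op k) l =
  [set f | forall i, ~ (`|k i| <= l) -> coef f i = 0].
Proof.
apply: closed_span_coefP.
  by move=> i ki; exists (k i) => //; apply/diag_eigenvector_basis.
move=> g i [a al []]; rewrite diag_eigenspaceP => ga _ ki.
by apply: ga => ka; apply: ki; rewrite ka.
Qed.

Lemma basis_orthonormal : is_orthonormal_basis e.
Proof.
split=> [i|i j /eqP ij|]; first by rewrite e_orth eqxx.
  by rewrite e_orth (negbTE ij).
rewrite (@closed_span_coefP _ (fun=> True)).
- by apply/seteqP; split=> // f _ i nT; case: nT.
- by move=> i _; exists i.
- by move=> g i _ nT; case: nT.
Qed.

(** *** Compactness *)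

Definition vanishing (k : I -> R) := forall eps : R, 0 < eps ->
  exists n, forall i, (n < deg i)%N -> `|k i| <= eps.

Lemma vanishing_bounded k : vanishing k -> exists C : R, forall i, `|k i| <= C.
Proof.
move=> /(_ 1 ltr01)[n kn]; exists (1 + \sum_(i <- L n) `|k i|) => i.
have [iN|/kn k1] := leqP (deg i) n.
  by rewrite (bigD1_seq i) ?mem_L//= addrA addrAC lerDr addr_ge0// sumr_ge0.
by rewrite (le_trans k1)// lerDl sumr_ge0.
Qed.

Lemma cvg_sum0 (X : Type) (s : seq I) (g : I -> X -> R) (F : set_system X) :
  Filter F -> (forall i, g i x @[x --> F] --> 0) ->
  \sum_(i <- s) g i x @[x --> F] --> 0.
Proof.
move=> FF g0; elim: s => [|i s IH].
  by under eq_fun do rewrite big_nil; exact: cvg_cst.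
under eq_fun do rewrite big_cons.
have := cvgD (g0 i) IH; rewrite addr0; exact.
Qed.

Lemma near_coef_dist (F : set_system (I -> R)) (b : I -> R) (s : seq I) (eps : R) :
  Filter F -> (forall i, f i @[f --> F] --> b i) -> 0 < eps ->
  F [set f | \sum_(i <- s) (f i - b i) ^+ 2 < eps].
Proof.
move=> FF Fb eps0; have g0 i : (f i - b i) ^+ 2 @[f --> F] --> (0 : R).
  have ci : f i - b i @[f --> F] --> (0 : R).
    by have := cvgB (Fb i) (cvg_cst (b i)); rewrite subrr; exact.
  by have := cvgM ci ci; rewrite mulr0; exact.
have /cvgrPdist_lt/(_ _ eps0) := cvg_sum0 s FF g0.
apply: filterS => f /=; rewrite sub0r normrN; apply: le_lt_trans.
exact: ler_norm.
Qed.

(** The sequences of coefficients live in a product of segments, compact by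
    Tychonoff. A neighbourhood of a cluster point [b] can constrain the finitely
    many coordinates of a level at once. *)
Lemma coef_cluster (a : nat -> I -> R) (C : R) : (forall n i, `|a n i| <= C) ->
  exists b : I -> R, forall N (eps : R) n0, 0 < eps ->
    exists2 n, (n0 <= n)%N & \sum_(i <- L N) (a n i - b i) ^+ 2 < eps.
Proof.
move=> aC.
have cK := @tychonoff I (fun=> R) (fun=> [set` `[- C, C]])
  (fun=> segment_compact (a := - C) (b := C)).
have aK : (a @ \oo) [set f : I -> R | forall i, (f i) \in `[- C, C]].
  by exists 0%N => // n _ i /=; rewrite in_itv/= -ler_norml.
have [b [_ clb]] := cK (a @ \oo) _ aK.
exists b => N eps n0 eps0.
have aN : (a @ \oo) [set a n | n in [set n | (n0 <= n)%N]].
  by exists n0 => // n /= nn; exists n.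
have bN : nbhs (b : prod_topology (fun _ : I => R))
    [set f : I -> R | \sum_(i <- L N) (f i - b i) ^+ 2 < eps].
  apply: near_coef_dist => [|i|//].
    exact: (@nbhs_filter (prod_topology (fun _ : I => R)) b).
  exact: (@proj_continuous I (fun=> R) i b).
have [_ [[n nn <-] an]] := clb _ _ aN bN.
by exists n.
Qed.

(** Coefficients up to level [n] are multiplied by at most [C], the others by at
    most [eps]. *)
Lemma diag_op_tail k (C eps : R) n f h : diag_op k f h ->
  (forall i, `|k i| <= C) -> (forall i, (n < deg i)%N -> `|k i| <= eps) ->
  dotL2 h h <= C ^+ 2 * \sum_(i <- L n) coef f i ^+ 2 + eps ^+ 2 * dotL2 f f.
Proof.
move=> fh kC kn; have hP := @Parseval h h; have /cvg_lim <- // := hP.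
apply: limr_le; first by apply/cvg_ex; eexists; exact: hP.
exists n => // m /= nm; rewrite (big_L_widen _ nm).
apply: le_trans (lerD (lexx _) (ler_wpM2l (sqr_ge0 eps) (Bessel m f))).
rewrite [X in C ^+ 2 * X]big_mkcond/= !mulr_sumr -big_split/=.
apply: ler_sum => i _.
rewrite fh -expr2 exprMn -(real_normK (num_real (k i))).
have k0 := normr_ge0 (k i); have ki := kC i; have f2 := sqr_ge0 (coef f i).
case: leqP => [_|/kn ke].
  apply: le_trans (_ : C ^+ 2 * coef f i ^+ 2 <= _); last first.
    by rewrite lerDl mulr_ge0 ?sqr_ge0.
  by rewrite ler_wpM2r// lerXn2r// nnegrE (le_trans k0).
by rewrite mulr0 add0r ler_wpM2r// lerXn2r// nnegrE (le_trans k0).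
Qed.

Lemma combinB c c' n : combin c n - combin c' n = combin (fun i => c i - c' i) n.
Proof. by rewrite -sumrB; apply: eq_bigr => i _; rewrite scalerBl. Qed.

(** A cluster point of the coefficient sequences of [u] is square summable with the
    same bound, hence comes from some [g]. The [j]-th term of the subsequence is
    chosen close to [g] on level [j]; the image of the difference is then small on
    any fixed level by this choice, and beyond that level because [k] vanishes at
    infinity. *)
Lemma diag_op_compact k : vanishing k -> compact_op (diag_op k).
Proof.
move=> kv; have [C kC] := vanishing_bounded kv; split.
- exact: diag_op_linear.
- by move=> f; exact: diag_op_total kC.
move=> u w B uB uw.
have B0 : 0 <= B by exact: le_trans (normL2_ge0 (u 0%N)) (uB 0%N).
have aB n i : `|coef (u n) i| <= B.
  apply: le_trans (le_dotL2_norm _ _) _; rewrite -[leRHS]mulr1; apply: ler_pM => //;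
    rewrite ?normL2_ge0//.
  by rewrite /normL2 e_orth eqxx sqrtr1.
have [b clb] := coef_cluster aB.
have bB n : \sum_(i <- L n) b i ^+ 2 <= B ^+ 2.
  rewrite -dot_combin_sqr -sqr_normL2 lerXn2r ?nnegrE ?normL2_ge0//.
  apply/ler_addgt0Pr => eps eps0.
  have [m _ um] := clb n (eps ^+ 2) 0%N (exprn_gt0 2 eps0).
  rewrite -[combin b n](subrK (cutoff n (u m))) addrC.
  apply: le_trans (ler_normL2D _ _) _; apply: lerD.
    apply: le_trans (uB m); apply: normL2_combin; first exact: normL2_ge0.
    by rewrite sqr_normL2 Bessel.
  by rewrite normL2B combinB; apply: normL2_combin; rewrite ltW.
have [g [gb _]] := combin_cvg bB.
have gB : normL2 g <= B by apply: Bessel_le => // n; under eq_bigr do rewrite gb.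
have [h gh] := diag_op_total g kC.
have /choice[F HF] : forall p : nat * nat, exists n, (p.1 <= n)%N /\
    \sum_(i <- L p.2) (coef (u n) i - b i) ^+ 2 < (p.2.+1%:R)^-1.
  move=> [n0 N]; have [|n n0n un] := clb N (N.+1%:R^-1) n0; last by exists n.
  by rewrite invr_gt0.
pose kk := fix kk j := if j is j'.+1 then F ((kk j').+1, j) else F (0%N, 0%N).
have kkF j : \sum_(i <- L j) (coef (u (kk j)) i - b i) ^+ 2 < (j.+1%:R)^-1.
  by case: j => [|j]; [have [] := HF (0, 0)%N|have [] := HF ((kk j).+1, j.+1)].
exists kk, h; split.
  by apply: (homo_ltn ltn_trans) => j; have [] := HF ((kk j).+1, j.+1).
apply/cvgL2P => eps eps0.
have tail j n (del : R) : (forall i, (n < deg i)%N -> `|k i| <= del) -> (n <= j)%N ->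
    normL2 (w (kk j) - h) ^+ 2 <= C ^+ 2 * (j.+1%:R)^-1 + del ^+ 2 * (2 * B) ^+ 2.
  move=> kn nj; rewrite sqr_normL2.
  have wh : diag_op k (u (kk j) - g) (w (kk j) - h).
    by move=> i; rewrite !coefL2B uw gh; ring.
  apply: le_trans (diag_op_tail wh kC kn) _; apply: lerD.
    rewrite ler_wpM2l ?sqr_ge0//; apply: le_trans (ltW (kkF j)).
    rewrite (big_L_widen _ nj) [leRHS](eq_bigr (fun i => coef (u (kk j) - g) i ^+ 2)).
      by rewrite big_mkcond; apply: ler_sum => i _; case: ifP => // _; exact: sqr_ge0.
    by move=> i _; rewrite coefL2B gb.
  rewrite ler_wpM2l ?sqr_ge0// -sqr_normL2 lerXn2r ?nnegrE ?normL2_ge0 ?mulr_ge0//.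
  rewrite (le_trans (ler_normL2D _ _))// normL2N mulr2n mulrDl mul1r lerD//.
have e2 : 0 < eps ^+ 2 / 2 by rewrite divr_gt0// exprn_gt0.
(* The tail then contributes at most [(2 B eps / (4 B + 1))^2 <= eps^2 / 4]. *)
have [n kn] : exists n, forall i, (n < deg i)%N -> `|k i| <= eps / (4 * B + 1).
  by apply: kv; rewrite divr_gt0// ltr_wpDl// mulr_ge0.
have lim0 : (fun j => C ^+ 2 * (j.+1%:R)^-1) @ \oo --> (0 : R).
  rewrite -(mulr0 (C ^+ 2)); apply: cvgM; first exact: cvg_cst.
  exact: cvg_harmonic.
have /cvgrPdist_lt/(_ _ e2)[N _ NC] := lim0.
exists (maxn n N) => j; rewrite geq_max => /andP[nj Nj].
rewrite -(@ltr_pXn2r _ 2) ?nnegrE ?normL2_ge0 ?(ltW eps0)//.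
apply: le_lt_trans (tail j n _ kn nj) _.
have := NC j Nj; rewrite /= sub0r normrN => /(le_lt_trans (ler_norm _)) Cj.
rewrite (splitr (eps ^+ 2)) ltr_leD//.
have B1 : 0 < 4 * B + 1 by rewrite ltr_wpDl// mulr_ge0.
rewrite (_ : _ * _ = eps ^+ 2 * (2 * B / (4 * B + 1)) ^+ 2); last by ring.
rewrite ler_wpM2l ?sqr_ge0//.
have : 0 <= 2 * B / (4 * B + 1) <= 2^-1.
  apply/andP; split; first by rewrite divr_ge0 ?mulr_ge0// ltW.
  by rewrite ler_pdivrMr//; lra.
move: (_ / _) => x /andP[x0 x2]; nra.
Qed.

(** The point [1] is at distance at least [1] from the eigenvalues. At any [z] of
    the resolvent set no eigenvalue equals [z], and the resolvent is the diagonal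
    operator of the [(k i - z)^-1], which vanish at infinity. *)
Lemma diag_compact_resolvent k : (forall i, k i <= 0) ->
  (forall B : R, exists n, forall i, (n < deg i)%N -> k i <= - B) ->
  compact_resolvent (diag_op k).
Proof.
move=> k0 kinf; split.
  exists 1; rewrite /resolvent_set diag_op_shift diag_op_inv; last first.
    by move=> i; rewrite lt_eqF//; have := k0 i; lra.
  apply: (@diag_op_bounded _ 1) => i.
  have ki : 1 <= `|k i - 1|.
    by rewrite ler0_norm ?opprB; have := k0 i; lra.
  by rewrite normfV invf_le1// (lt_le_trans ltr01).
move=> z; rewrite /resolvent_set diag_op_shift => /diag_op_inv_neq0 nz.
rewrite diag_op_inv//; apply: diag_op_compact => eps eps0.
have [n kn] := kinf (`|z| + eps^-1); exists n => i /kn ki.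
have ge : eps^-1 <= `|k i - z|.
  have := ler_norm (- (k i - z)); have := ler_norm (- z); rewrite !normrN; lra.
rewrite normfV -[leRHS]invrK lef_pV2// posrE ?invr_gt0//.
by apply: lt_le_trans ge; rewrite invr_gt0.
Qed.

(** ** The operator of a diagonal form *)

Section DiagonalForm.
Variables (E : set (L2 mu)) (q : L2 mu -> L2 mu -> R) (lam : I -> R).
Hypothesis lam_ge0 : forall i, 0 <= lam i.
Hypothesis EP : forall f, E f <-> exists n, f = cutoff n f.
Hypothesis qE : forall f g n, f = cutoff n f -> g = cutoff n g ->
  q f g = \sum_(i <- L n) lam i * coef f i * coef g i.

Lemma cutoff_widen f m n : (m <= n)%N -> f = cutoff m f -> f = cutoff n f.
Proof.
move=> mn fm; rewrite [LHS]fm /cutoff /combin (big_L_widen _ mn).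
rewrite big_mkcond; apply: eq_bigr => i _; case: ifP => // im.
by rewrite fm coef_cutoff im scale0r.
Qed.

Lemma cutoffB f g n : cutoff n (f - g) = cutoff n f - cutoff n g.
Proof.
rewrite /cutoff combinB; apply: eq_bigr => i _; by rewrite coefL2B.
Qed.

Lemma cutoffK n f : cutoff n (cutoff n f) = cutoff n f.
Proof.
rewrite /cutoff /combin big_seq [RHS]big_seq; apply: eq_bigr => i.
by rewrite mem_L => iN; rewrite -/(combin _ n) coef_combin iN.
Qed.

Lemma E_cutoff n f : E (cutoff n f).
Proof. by apply/EP; exists n; rewrite cutoffK. Qed.

Lemma E_sub f g : E f -> E g -> E (f - g).
Proof.
move=> /EP[m fm] /EP[n gn]; apply/EP; exists (maxn m n); rewrite cutoffB.
by rewrite -(cutoff_widen (leq_maxl m n) fm) -(cutoff_widen (leq_maxr m n) gn).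
Qed.

(** The form is [<half f, half g>], with [half] the square root of the diagonal
    operator of [lam]. *)
Let half := diag_op (fun i => Num.sqrt (lam i)).

Let half_unique f g g' : half f g -> half f g' -> normL2 (g - g') = 0.
Proof. by move=> fg fg'; apply: coef_inj => i; rewrite fg fg'. Qed.

Let E_half f : E f -> exists f', half f f'.
Proof.
move=> /EP[n fn]; exists (combin (fun i => Num.sqrt (lam i) * coef f i) n) => i.
by rewrite coef_combin [in RHS]fn coef_cutoff; case: ifP => //; rewrite mulr0.
Qed.

Let q_half f g f' g' : E f -> E g -> half f f' -> half g g' -> q f g = dotL2 f' g'.
Proof.
move=> /EP[m fm] /EP[n gn] ff gg.
have P := @Parseval f' g'; have /cvg_lim <- // := P.
apply/esym/cvg_lim => //; apply: cvg_near_cst; exists (maxn m n) => // k /=.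
rewrite geq_max => /andP[mk nk].
rewrite (qE (cutoff_widen mk fm) (cutoff_widen nk gn)); apply: eq_bigr => i _.
by rewrite ff gg mulrACA -expr2 sqr_sqrtr// mulrA.
Qed.

Let half_sub f g f' g' : half f f' -> half g g' -> half (f - g) (f' - g').
Proof. by move=> ff gg i; rewrite !coefL2B ff gg mulrBr. Qed.

(** The energy of a difference is the squared norm of its image by [half]; [half] is
    closed because coefficients are continuous. *)
Let approx_half f u : form_approx E q f u -> exists f' u',
  [/\ half f f', forall n, half (u n) (u' n) & cvgL2 u' f'].
Proof.
move=> [Eu uf uC]; have /choice[u' uu'] := fun n => E_half (Eu n).
have /L2_complete[f' uf'] : cauchyL2 u'.
  move=> eps eps0; have [N uN] := uC _ (exprn_gt0 2 eps0); exists N => m n Nm Nn.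
  rewrite -(@ltr_pXn2r _ 2) ?nnegrE ?normL2_ge0 ?(ltW eps0)// sqr_normL2.
  rewrite -(q_half _ _ (half_sub (uu' m) (uu' n)) (half_sub (uu' m) (uu' n))) ?uN//;
  exact: E_sub.
exists f', u'; split=> // i.
have c1 := coef_cvg (i := i) uf'.
have c2 : (fun n => coef (u' n) i) @ \oo --> Num.sqrt (lam i) * coef f i.
  rewrite (_ : (fun n => _) = fun n => Num.sqrt (lam i) * coef (u n) i).
    by apply: cvgM; [exact: cvg_cst|exact: coef_cvg].
  by apply/funext => n; exact: uu'.
exact: cvg_unique c1 c2.
Qed.

Let half_approx f f' : half f f' -> form_approx E q f (cutoff^~ f).
Proof.
move=> ff; split; [by move=> n; exact: E_cutoff|exact: cutoff_cvg|].
move=> eps eps0; have eps2 : 0 < Num.sqrt eps / 2 by rewrite divr_gt0// sqrtr_gt0.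
have [N fN] := (cvgL2P _ _).1 (@cutoff_cvg f') _ eps2.
have pf n : half (cutoff n f) (cutoff n f').
  by move=> i; rewrite !coef_cutoff; case: ifP; rewrite ?mulr0// ff.
exists N => m n Nm Nn.
rewrite (q_half _ _ (half_sub (pf m) (pf n)) (half_sub (pf m) (pf n)));
  [|by apply: E_sub; exact: E_cutoff..].
rewrite -sqr_normL2 -[ltRHS]sqr_sqrtr ?ltW//.
rewrite ltr_pXn2r ?nnegrE ?normL2_ge0 ?sqrtr_ge0//.
rewrite (_ : _ - _ = (cutoff m f' - f') - (cutoff n f' - f')); last first.
  by rewrite opprB addrA subrK.
rewrite (splitr (Num.sqrt eps)); apply: le_lt_trans (ler_normL2D _ _) _.
by rewrite normL2N; apply: ltrD; exact: fN.
Qed.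

Let basis_half i : half (e i) (Num.sqrt (lam i) *: e i).
Proof.
by move=> j; rewrite coefL2Z coef_basis; case: eqP => [->|]; rewrite ?mulr0.
Qed.

(** By [approx_half] and [half_approx] the closure of the form is [<half f, half g>]
    on the domain of [half]. Testing with basis vectors gives the coefficients of
    [h]. Conversely Parseval extends the identity to all test functions, and
    [lam_i f_i^2 = - h_i f_i <= f_i^2 + h_i^2] puts [f] in the domain of [half]. *)
Lemma form_operator_diag : form_operator E q = diag_op (fun i => - lam i).
Proof.
apply/funext => f; apply/funext => h; apply/propext; split.
  move=> [_ fh] i.
  have [u [w [fu ew quw]]] := fh (e i) (ex_intro _ _ (half_approx (basis_half i))).
  have [f' [u' [ff uu uf']]] := approx_half fu.
  have [g' [w' [eg ww wg']]] := approx_half ew.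
  have [Eu _ _] := fu; have [Ew _ _] := ew.
  have lim2 : (fun n => q (u n) (w n)) @ \oo --> dotL2 f' g'.
    rewrite (_ : (fun n => _) = fun n => dotL2 (u' n) (w' n)); first exact: cvgL2_dot.
    by apply/funext => n; rewrite (q_half (Eu n) (Ew n) (uu n) (ww n)).
  have hq : - coef h i = dotL2 f' g' by exact: cvg_unique quw lim2.
  apply: oppr_inj; rewrite hq /= [X in _ = - X]mulNr opprK.
  have -> : dotL2 f' g' = dotL2 f' (Num.sqrt (lam i) *: e i).
    apply/eqP; rewrite -subr_eq0 -dotL2Br -normr_le0.
    apply: le_trans (le_dotL2_norm _ _) _.
    by rewrite (half_unique eg (basis_half i)) mulr0.
  by rewrite dotL2Zr -/(coef f' i) ff mulrA -expr2 sqr_sqrtr.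
move=> fh.
have lamf i : lam i * coef f i = - coef h i by rewrite fh mulNr opprK.
have [f' [f'c _]] : exists f', (forall i, coef f' i = Num.sqrt (lam i) * coef f i) /\
    cvgL2 (combin (fun i => Num.sqrt (lam i) * coef f i)) f'.
  apply: (@combin_cvg _ (dotL2 f f + dotL2 h h)) => n.
  apply: le_trans (lerD (Bessel n f) (Bessel n h)); rewrite -big_split/=.
  apply: ler_sum => i _; rewrite exprMn sqr_sqrtr// expr2 mulrA lamf.
  have := sqr_ge0 (coef f i + coef h i); have := sqr_ge0 (coef f i).
  have := sqr_ge0 (coef h i); rewrite sqrrD; lra.
have fapp := half_approx f'c.
split=> [|g [w gw]]; first by exists (cutoff^~ f).
have [g' [_ [gg _ _]]] := approx_half gw.
exists (cutoff^~ f), (cutoff^~ g); split=> //; first exact: half_approx gg.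
rewrite (_ : (fun n => _) = fun n => - \sum_(i <- L n) coef h i * coef g i).
  by apply: cvgN; exact: Parseval.
apply/funext => n; rewrite (@qE _ _ n) ?cutoffK// -sumrN.
by apply: big_LE => i iN; rewrite !coef_cutoff iN lamf mulNr.
Qed.

End DiagonalForm.
End GradedBasis.

(** * Walsh characters and the Haar basis *)

Lemma take_mkseq (T : Type) (x : nat -> T) m n :
  (m <= n)%N -> take m (mkseq x n) = mkseq x m.
Proof. by move=> mn; rewrite /mkseq -map_take take_iota (minn_idPl mn). Qed.

HB.instance Definition _ := gen_eqMixin haar_index.

Lemma haar_index_eqP (w w' : haar_index) : w = w' <-> sval w =1 sval w'.
Proof.
split=> [->//|/funext]; case: w w' => [w hw] [w' hw'] /= ww'.
by move: hw'; rewrite -ww' => hw'; congr exist; exact: Prop_irrelevance.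
Qed.

Lemma wlen_leP (w : haar_index) n :
  reflect (forall k, (n <= k)%N -> sval w k = false) (wlen w <= n)%N.
Proof.
apply: (iffP idP) => [wn k nk|wn].
  by apply: (wlenP w).2; exact: leq_trans nk.
rewrite leqNgt; apply/negP => nw.
have := (wlenP w).1 (leq_ltn_trans (leq0n n) nw).
by rewrite wn// -ltnS prednK// (leq_ltn_trans (leq0n n) nw).
Qed.

Lemma pad_subproof n (t : n.-tuple bool) :
  exists N, forall k, (N <= k)%N -> nth false t k = false.
Proof. by exists n => k nk; rewrite nth_default// size_tuple. Qed.

Definition pad n (t : n.-tuple bool) : haar_index :=
  exist _ (nth false t) (pad_subproof t).

Lemma pad_inj n : injective (@pad n).
Proof.
move=> t t' /haar_index_eqP tt'; apply: val_inj; apply: (@eq_from_nth _ false).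
  by rewrite !size_tuple.
by move=> i _; exact: tt'.
Qed.

Lemma wlen_pad n (t : n.-tuple bool) : (wlen (pad t) <= n)%N.
Proof. by apply/wlen_leP => k nk /=; rewrite nth_default// size_tuple. Qed.

Lemma pad_onto (w : haar_index) n : (wlen w <= n)%N -> exists t : n.-tuple bool, w = pad t.
Proof.
move=> wn; exists [tuple sval w i | i < n]; apply/haar_index_eqP => k /=.
have [nk|kn] := leqP n k; last first.
  by rewrite (nth_map (Ordinal kn)) ?size_enum_ord// nth_enum_ord.
by rewrite (wlen_leP _ _ wn)// nth_default// size_map size_enum_ord.
Qed.

Definition haar_level n : seq haar_index := map (@pad n) (enum {: n.-tuple bool}).

Lemma haar_level_uniq n : uniq (haar_level n).
Proof. by rewrite map_inj_uniq ?enum_uniq//; exact: pad_inj. Qed.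

Lemma mem_haar_level n w : (w \in haar_level n) = (wlen w <= n)%N.
Proof.
apply/mapP/idP => [[t _ ->]|]; first exact: wlen_pad.
by move=> /pad_onto[t ->]; exists t => //; rewrite mem_enum.
Qed.

Lemma big_haar_level (V : nmodType) n (F : haar_index -> V) :
  \sum_(w <- haar_level n) F w = \sum_(t : n.-tuple bool) F (pad t).
Proof. by rewrite big_map big_enum. Qed.

Lemma size_word_subproof (x : nat -> bool) n : size (mkseq x n) == n.
Proof. by rewrite size_mkseq. Qed.

Definition word n (x : nat -> bool) : n.-tuple bool := Tuple (size_word_subproof x n).

Section Walsh.
Variable R : realType.
Implicit Types (x y : nat -> bool).

(** The character of [(Z/2)^n] with index [x], evaluated at [y]. *)
Definition walsh n x y : R := (-1) ^+ (\sum_(k < n) x k * y k)%N.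

Lemma walshC n x y : walsh n x y = walsh n y x.
Proof. by rewrite /walsh; under eq_bigr do rewrite mulnC. Qed.

Lemma eq_walsh n x x' y y' : (forall k, (k < n)%N -> x k = x' k) ->
  (forall k, (k < n)%N -> y k = y' k) -> walsh n x y = walsh n x' y'.
Proof.
by move=> xx yy; congr (_ ^+ _); apply: eq_bigr => k _; rewrite xx// yy.
Qed.

Lemma sum_tuple_prod n (F : 'I_n -> bool -> R) :
  \sum_(t : n.-tuple bool) \prod_(k < n) F k (tnth t k) =
  \prod_(k < n) (F k false + F k true).
Proof.
transitivity (\prod_(k < n) \sum_(b : bool) F k b); last first.
  by apply: eq_bigr => k _; rewrite big_bool addrC.
rewrite bigA_distr_bigA.
rewrite (reindex (fun f : {ffun 'I_n -> bool} => [tuple f i | i < n]))/=.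
  by apply: eq_bigr => f _; apply: eq_bigr => k _; rewrite tnth_mktuple.
exists (fun t : n.-tuple bool => [ffun i => tnth t i]) => [f|t] _.
  by apply/ffunP => i; rewrite ffunE tnth_mktuple.
by apply: eq_from_tnth => i; rewrite tnth_mktuple ffunE.
Qed.

(** Orthogonality of the characters of the group [(Z/2)^n]: the sum
    factorizes over the coordinates. *)
Lemma sum_walsh n x y :
  \sum_(t : n.-tuple bool) walsh n (nth false t) x * walsh n (nth false t) y =
  if mkseq x n == mkseq y n then 2 ^+ n else 0.
Proof.
rewrite (eq_bigr (fun t : n.-tuple bool =>
  \prod_(k < n) ((-1) ^+ (tnth t k * x k + tnth t k * y k)%N : R))); last first.
  move=> t _; rewrite /walsh -exprD -big_split/= -prodrXr.
  by apply: eq_bigr => k _; rewrite !(tnth_nth false).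
rewrite (sum_tuple_prod (fun k b => (-1) ^+ (b * x k + b * y k)%N)).
case: eqP => [xy|xy].
  rewrite (eq_bigr (fun=> 2)) ?prodr_const ?card_ord// => k _.
  have -> : x k = y k by have := congr1 (nth false ^~ k) xy; rewrite !nth_mkseq.
  by case: (y k) => /=; rewrite ?(mul0n, muln0, mul1n, add0n); ring.
have [k xyk] : exists k : 'I_n, x k != y k.
  apply: contrapT => nk; apply: xy; apply: (@eq_from_nth _ false).
    by rewrite !size_mkseq.
  move=> i; rewrite size_mkseq => iN; rewrite !nth_mkseq//.
  by apply/eqP/negPn/negP => xi; apply: nk; exists (Ordinal iN).
rewrite (bigD1 k)//=; move: xyk; case: (x k); case: (y k) => // _;
  by rewrite ?(mul0n, muln0, mul1n, addn0, add0n, expr0, expr1, subrr, mul0r).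
Qed.

Lemma chiE v (x : C3) : chi R v x = (mkseq x (size v) == v)%:R.
Proof.
rewrite /chi indicE; congr (nat_of_bool _)%:R; apply/idP/idP.
  by rewrite inE => /eqP.
by move/eqP => xv; rewrite inE.
Qed.

Lemma sum_chi n (F : n.-tuple bool -> R) (x : C3) :
  \sum_(v : n.-tuple bool) F v * chi R v x = F (word n x).
Proof.
rewrite (bigD1 (word n x))//= chiE size_mkseq eqxx mulr1.
rewrite big1 ?addr0// => v vx; rewrite chiE size_tuple.
by rewrite eq_sym -val_eqE/= in vx; rewrite (negbTE vx) mulr0.
Qed.

(** The entries of [w] beyond its length vanish, so any larger number of letters
    gives the same sign. *)
Lemma haar_funE n w (x : C3) : (wlen w <= n)%N -> haar_fun R w x = walsh n (sval w) x.
Proof.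
move=> wn; rewrite /haar_fun (sum_chi (fun v => (-1) ^+ _)); congr (_ ^+ _).
rewrite (big_ord_widen_cond _ xpredT
  (fun k => (sval w k * nth false (mkseq x (wlen w)) k)%N) wn).
rewrite big_mkcond; apply: eq_bigr => k _ /=; case: ltnP => kw.
  by rewrite nth_mkseq.
by rewrite (wlen_leP _ _ (leqnn _)).
Qed.

End Walsh.

Section HaarBasis.
Variables (R : realType) (mu : probability C3 R).
Hypothesis mu_cantor : is_cantor_measure mu.

Definition chiL2 v : L2 mu := Lfun_Sub (lee1n 2) (chi_Lfun mu v).

Lemma dot_chi v : dotL2 (chiL2 v) (chiL2 v) = 2 ^- size v.
Proof.
rewrite /dotL2 /Rintegral (eq_integral (fun x => (\1_(cyl v) x)%:E)); last first.
  by move=> x _ /=; rewrite -/(chi R v) !chiE; case: eqP; rewrite ?mulr0 ?mulr1.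
rewrite integral_indic ?setIT//; last exact: measurable_cyl.
exact: (congr1 (@fine R) (mu_cantor v)).
Qed.

Lemma dot_chi_tuple n (u v : n.-tuple bool) :
  dotL2 (chiL2 u) (chiL2 v) = (u == v)%:R * 2 ^- n.
Proof.
have [<-|uv] := eqVneq u v; first by rewrite mul1r dot_chi size_tuple.
rewrite mul0r /dotL2 /Rintegral (eq_integral (cst 0%E)) ?integral0// => x _.
rewrite /= -[chi R u x * chi R v x]/(_ * _) !chiE !size_tuple.
case: eqP => [->|]; last by rewrite mul0r.
by rewrite val_eqE (negbTE uv) mulr0.
Qed.

Lemma haar_pad n (t : n.-tuple bool) :
  haar mu (pad t) = \sum_(v : n.-tuple bool) walsh R n (nth false t) (nth false v) *: chiL2 v.
Proof.
apply/LfuneqP => x; rewrite L2_sumE -[LHS]/(haar_fun R (pad t) x).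
rewrite (haar_funE _ _ (wlen_pad t)).
have := sum_chi (fun v : n.-tuple bool => walsh R n (nth false t) (nth false v)) x.
move=> /= -> ; apply: eq_walsh => // k kn.
by rewrite nth_mkseq.
Qed.

Lemma chi_haar n (v : n.-tuple bool) : chiL2 v =
  \sum_(t : n.-tuple bool) (2 ^- n * walsh R n (nth false t) (nth false v)) *: haar mu (pad t).
Proof.
apply/LfuneqP => x; rewrite L2_sumE -[LHS]/(chi R v x) chiE size_tuple.
transitivity (2 ^- n * \sum_(t : n.-tuple bool)
    (walsh R n (nth false t) (nth false v) * walsh R n (nth false t) x)).
  rewrite sum_walsh.
  have -> : mkseq (nth false v) n = v by rewrite -[X in mkseq _ X](size_tuple v) mkseq_nth.
  by rewrite eq_sym; case: eqP; rewrite ?mulr0// mulVf// expf_neq0.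
rewrite mulr_sumr; apply: eq_bigr => t _; rewrite mulrA; congr (_ * _).
by rewrite -(haar_funE R x (wlen_pad t)).
Qed.

Lemma dot_haar w w' : dotL2 (haar mu w) (haar mu w') = (w == w')%:R.
Proof.
have [n [t [t' [-> ->]]]] : exists n (t t' : n.-tuple bool), w = pad t /\ w' = pad t'.
  have [t wt] := pad_onto (leq_maxl (wlen w) (wlen w')).
  have [t' wt'] := pad_onto (leq_maxr (wlen w) (wlen w')).
  by exists (maxn (wlen w) (wlen w')), t, t'.
rewrite !haar_pad dotL2_suml (inj_eq (@pad_inj n)).
rewrite (eq_bigr (fun v : n.-tuple bool => 2 ^- n * (walsh R n (nth false v) (nth false t) *
  walsh R n (nth false v) (nth false t')))); last first.
  move=> v _; rewrite dotL2Zl dotL2_sumr (bigD1 v)//= dotL2Zr dot_chi_tuple eqxx mul1r.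
  rewrite big1 ?addr0 => [|u uv]; last first.
    by rewrite dotL2Zr dot_chi_tuple eq_sym (negbTE uv) mul0r mulr0.
  rewrite mulrA mulrC (walshC _ n (nth false t)) (walshC _ n (nth false t')).
by rewrite mulrA.
rewrite -mulr_sumr sum_walsh.
have mk (s : n.-tuple bool) : mkseq (nth false s) n = s.
  by rewrite -[X in mkseq _ X](size_tuple s) mkseq_nth.
by rewrite !mk val_eqE; case: eqP; rewrite ?mulr0// mulVf// expf_neq0.
Qed.

Lemma cyl_setI_closed : setI_closed [set A | A = set0 \/ exists v, A = cyl v].
Proof.
have sub u v : (size u <= size v)%N -> cyl u `&` cyl v = set0 \/ cyl u `&` cyl v = cyl v.
  move=> uv; have [uvE|uvN] := eqVneq (take (size u) v) u; [right|left].
    apply/seteqP; split=> [x []//|x vx]; split=> //; rewrite /cyl/= -[in RHS]uvE -vx.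
    by rewrite take_mkseq.
  apply/seteqP; split=> [x [ux vx]|//]; case/eqP: uvN.
  by rewrite -vx take_mkseq.
move=> A B [->|[u ->]]; first by rewrite set0I; left.
move=> [->|[v ->]]; first by rewrite setI0; left.
have [uv|/ltnW vu] := leqP (size u) (size v).
  by have [->|->] := sub _ _ uv; [left|right; exists v].
by rewrite setIC; have [->|->] := sub _ _ vu; [left|right; exists u].
Qed.

(** Every open set of the Cantor space is the union of the countably many
    cylinders that it contains. *)
Lemma cyl_generate : (@measurable _ C3) = <<s [set A | A = set0 \/ exists v, A = cyl v] >>.
Proof.
apply/seteqP; split; last first.
  apply: smallest_sub; first exact: sigma_algebra_measurable.
  by move=> A [->|[v ->]]; [exact: measurable0|exact: measurable_cyl].
apply: smallest_sub; first exact: smallest_sigma_algebra.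
move=> U oU; pose F k := if unpickle k is Some v then
    (if `[< cyl v `<=` U >] then cyl v else set0) else set0.
have -> : U = \bigcup_k F k.
  apply/seteqP; split=> [x Ux|x [k _]]; last first.
    by rewrite /F; case: unpickle => // v; case: asboolP => // vU /vU.
  pose G := filter_from [set: nat] (fun n => cyl (mkseq x n)).
  have FG : Filter G.
    apply: filter_from_filter; first by exists 0%N.
    move=> m n _ _; exists (maxn m n) => // y; rewrite /cyl /mkset !size_mkseq => xy.
    have xyk k : (k < maxn m n)%N -> y k = x k.
      by move=> kmn; have := congr1 (nth false ^~ k) xy; rewrite !nth_mkseq.
    by split; apply: (@eq_from_nth _ false); rewrite ?size_mkseq// => i iN;
      rewrite !nth_mkseq// xyk// leq_max iN ?orbT.
  have Gx : {ptws, G --> (x : nat -> bool)}.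
    apply/pointwise_cvgP => k A /nbhs_singleton Ak; exists k.+1 => // y.
    rewrite /cyl /mkset size_mkseq => /(congr1 (nth false ^~ k)).
    by rewrite !nth_mkseq// => yk; move: Ak; rewrite -yk.
  have nbhsU : nbhs (x : cantor_space) U by apply: open_nbhs_nbhs; split.
  have [n _ nU] : G U by exact: Gx.
  exists (pickle (mkseq x n)) => //; rewrite /F pickleK asboolT//.
  by rewrite /cyl /mkset size_mkseq.
have [_ _ UU] := @smallest_sigma_algebra C3 setT [set A | A = set0 \/ exists v, A = cyl v].
apply: UU => k; rewrite /F; case: unpickle => [v|].
  by case: asboolP => // _; apply: sub_gen_smallest; [right; exists v|left].
by apply: sub_gen_smallest; left.
Qed.

(** Orthogonality to the Haar functions makes the integrals over cylinders vanish;
    the sets over which the integral vanishes form a Dynkin system, and cylinders a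
    pi-system that generates the Borel sets. *)
Lemma haar_total (f : L2 mu) : (forall w, dotL2 f (haar mu w) = 0) -> normL2 f = 0.
Proof.
move=> f0.
have fchi v : dotL2 f (chiL2 v) = 0.
  rewrite -[v]/(val (in_tuple v)) chi_haar dotL2_sumr big1// => t _.
  by rewrite dotL2Zr f0 mulr0.
have intf : mu.-integrable [set: C3] (EFin \o f).
  by apply/Lfun1_integrable; have := Lfun_subset12 (fin_num_measure mu _ measurableT) (LfunP f).
have cyl0 v : (\int[mu]_(x in cyl v) (f x)%:E = 0)%E.
  rewrite integral_mkcond -[LHS]fineK; last first.
    rewrite -integral_mkcond; apply: integrable_fin_num; first exact: measurable_cyl.
    by apply: integrableS intf => //; exact: measurable_cyl.
  transitivity (dotL2 f (chiL2 v))%:E; last by rewrite fchi.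
  congr (fine _)%:E; apply: eq_integral => x _.
  rewrite /= /patch /chi indicE.
  by case: (x \in _); rewrite ?mulr1 ?mulr0.
have all0 A : measurable A -> (\int[mu]_(x in A) (f x)%:E = 0)%E.
  have intfA B : measurable B -> mu.-integrable B (EFin \o f).
    by move=> mB; exact: integrableS intf.
  have fT : (\int[mu]_x (f x)%:E = 0)%E.
    by rewrite -(cyl0 [::]); congr integral; apply/seteqP; split.
  move=> mA; have : <<s [set B | B = set0 \/ exists v, B = cyl v] >> A.
    by rewrite -cyl_generate.
  move: A {mA}; apply: (@dynkin_induction _ C3 _
    (fun A => (\int[mu]_(x in A) (f x)%:E = 0)%E) cyl_generate cyl_setI_closed).
  - exact: fT.
  - by move=> _ [->|[v ->]]; [rewrite integral_set0|exact: cyl0].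
  - move=> B mB B0; move: fT; rewrite -(setUv B) integral_setU ?setUv//.
    + by rewrite B0 add0e.
    + exact: measurableC.
    + exact/measurable_EFinP.
    + by rewrite disj_set2E setICr.
  - move=> F mF tF F0; rewrite integral_bigcup//; last by apply: intfA; exact: bigcupT_measurable.
    by rewrite eseries0.
apply/normL2_eq0.
have : ae_eq mu [set: C3] (EFin \o f) (cst 0%E).
  apply: integral_ae_eq => // A _ mA; by rewrite all0// integral0.
by apply: filterS => x fx /fx[].
Qed.

Lemma haar_graded : graded_basis (haar mu) wlen haar_level.
Proof.
split; [exact: dot_haar|exact: haar_level_uniq|exact: mem_haar_level|exact: haar_total].
Qed.

End HaarBasis.

(** * The form of the spectral triple *)

Section Blocks.
Variable R : realType.
Implicit Types (tau : Upsilon R) (f g : C3 -> R).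

Definition jump f tau v : R := f (sval tau v).1 - f (sval tau v).2.

Lemma vdiam_powR (s : R) v :
  ((vdiam R v)^-1) `^ (- s) * (vdiam R v)^-1 ^+ 2 = (3 `^ (2 - s)) ^+ size v.
Proof.
rewrite vdiamE invrK -[(3 ^+ _) ^+ 2]powR_mulrn ?exprn_ge0// -powRD; last first.
  by apply/implyP => _; rewrite expf_neq0.
rewrite -[in LHS]powR_mulrn// -powRrM mulrC powRrM powR_mulrn ?powR_ge0//.
by congr (_ `^ _ ^+ _); rewrite addrC.
Qed.

Definition ends f tau v (j : 'I_2) : R :=
  f (if j == ord0 then (sval tau v).1 else (sval tau v).2).

Lemma bcomm_entry f tau v i j :
  bcomm (@dirac_op R) (pi_rep tau f) v i j =
  ((vdiam R v)^-1 * (i != j)%:R * (ends f tau v j - ends f tau v i))%:C%C.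
Proof.
rewrite /bcomm /dirac_op /pi_rep mul_mx_diag mul_diag_mx !mxE.
rewrite -/(ends f tau v i) -/(ends f tau v j) !rmorphM/= rmorphB/= rmorph_nat.
ring.
Qed.

(** The commutator of [sigma1] with [diag (x, y)] is antidiagonal with entries
    [y - x] and [x - y], so the product of two of them is a scalar matrix. *)
Lemma block_trace (s : R) f g tau v :
  complex.Re (\tr (bmul (absD_pow (- s))
    (bmul (badj (bcomm (@dirac_op R) (pi_rep tau f))) (bcomm (@dirac_op R) (pi_rep tau g))) v)) =
  2 * (3 `^ (2 - s)) ^+ size v * (jump f tau v * jump g tau v).
Proof.
have cr (x : R) : Num.conj (x%:C%C) = x%:C%C by exact: conjc_real.
pose c := (vdiam R v)^-1.
have trE : \tr (bmul (badj (bcomm (@dirac_op R) (pi_rep tau f)))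
    (bcomm (@dirac_op R) (pi_rep tau g)) v) =
    (2 * c ^+ 2 * (jump f tau v * jump g tau v))%:C%C.
  rewrite /bmul /badj /mxtrace.
  under eq_bigr => i _.
    rewrite mxE; under eq_bigr => j _.
      rewrite [X in X * _]mxE [X in X * _]mxE !bcomm_entry cr -rmorphM/=; over.
    rewrite -rmorph_sum/=; over.
  rewrite -rmorph_sum/=; congr (_%:C)%C.
  rewrite !big_ord_recl !big_ord0 /jump /ends /= -/c; ring.
rewrite /bmul /absD_pow mul_scalar_mx mxtraceZ -/(bmul _ _ v) trE -rmorphM/=.
rewrite -vdiam_powR -/c; ring.
Qed.

End Blocks.

Lemma Rintegral_sum_indic (d : measure_display) (T : measurableType d) (R : realType)
    (P : probability T R) (J : Type) (r : seq J) (c : J -> R) (A : J -> set T) :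
  (forall j, measurable (A j)) ->
  \int[P]_x (\sum_(j <- r) c j * \1_(A j) x) = \sum_(j <- r) c j * fine (P (A j)).
Proof.
move=> mA.
have intA j : P.-integrable [set: T] (EFin \o (fun x => c j * \1_(A j) x)).
  rewrite (_ : _ \o _ = fun x => ((c j)%:E * (\1_(A j) x)%:E)%E)//.
  by apply: integrableZl => //; exact: integrable_indic.
rewrite /Rintegral.
transitivity (fine (\sum_(j <- r) \int[P]_x (c j * \1_(A j) x)%:E)%E).
  rewrite -integral_sum//; congr fine; apply: eq_integral => x _.
  by rewrite sumEFin.
rewrite (eq_bigr (fun j => (c j * fine (P (A j)))%:E)) ?sumEFin// => j _.
transitivity ((c j)%:E * \int[P]_x (\1_(A j) x)%:E)%E.
  by rewrite -integralZl//; exact: integrable_indic.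
by rewrite integral_indic// setIT EFinM fineK// fin_num_measure.
Qed.

Lemma integrable_sum_indic (d : measure_display) (T : measurableType d) (R : realType)
    (P : probability T R) (J : Type) (r : seq J) (c : J -> R) (A : J -> set T) :
  (forall j, measurable (A j)) ->
  P.-integrable [set: T] (EFin \o (fun x => \sum_(j <- r) c j * \1_(A j) x)).
Proof.
move=> mA.
rewrite (_ : _ \o _ = fun x => (\sum_(j <- r) (c j * \1_(A j) x)%:E)%E); last first.
  by apply/funext => x; rewrite sumEFin.
apply: integrable_sum => // j _.
rewrite (_ : (fun _ => _) = fun x => ((c j)%:E * (\1_(A j) x)%:E)%E)//.
by apply: integrableZl => //; exact: integrable_indic.
Qed.

Lemma Rintegral_sum (d : measure_display) (T : measurableType d) (R : realType)
    (P : probability T R) (J : Type) (r : seq J) (F : J -> T -> R) :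
  (forall j, P.-integrable [set: T] (EFin \o F j)) ->
  \int[P]_x (\sum_(j <- r) F j x) = \sum_(j <- r) \int[P]_x F j x.
Proof.
move=> intF; rewrite /Rintegral.
transitivity (fine (\sum_(j <- r) \int[P]_x (F j x)%:E)%E).
  by rewrite -integral_sum//; congr fine; apply: eq_integral => x _; rewrite sumEFin.
rewrite (eq_bigr (fun j => (fine (\int[P]_x (F j x)%:E)%E)%:E)) ?sumEFin// => j _.
by rewrite fineK//; apply: integrable_fin_num => //; exact: intF.
Qed.

Section Form.
Variables (R : realType) (mu : probability C3 R) (nu : probability (Upsilon R) R).
Hypothesis mu_cantor : is_cantor_measure mu.
Hypothesis nu_product : is_product_measure mu nu.

(** The measure of the intersection of the cylinder of [a] with one half of the
    cylinder of [v]; see [massE]. *)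
Let mass v b (a : vertex) : R := dotL2 (chiL2 mu a) (chiL2 mu (rcons v b)).

Let massE v b a : mu (cyl a `&` cyl (rcons v b)) = (mass v b a)%:E.
Proof.
rewrite /mass /dotL2 /Rintegral.
have mc := measurable_cyl.
rewrite (eq_integral (fun x => (\1_(cyl a `&` cyl (rcons v b)) x)%:E)); last first.
  by move=> x _ /=; rewrite indicI.
rewrite integral_indic ?setIT//; last exact: measurableI.
by rewrite fineK// fin_num_measure//; exact: measurableI.
Qed.

Let rcons_disj v : cyl (rcons v false) `&` cyl (rcons v true) = set0.
Proof.
apply/seteqP; split=> // x [] /cylP/(_ (size v)) + /cylP/(_ (size v)).
rewrite !size_rcons !nth_rcons ltnn eqxx => /(_ (ltnSn _)) -> /(_ (ltnSn _)).
by [].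
Qed.

Let prod_pair v a b : ((mu \x mu) ((cyl a `*` cyl b) `&` Upsilon_at v) =
  (mass v false a * mass v true b + mass v true a * mass v false b)%:E)%E.
Proof.
have mc := measurable_cyl.
have -> : (cyl a `*` cyl b) `&` Upsilon_at v =
   ((cyl a `&` cyl (rcons v false)) `*` (cyl b `&` cyl (rcons v true))) `|`
   ((cyl a `&` cyl (rcons v true)) `*` (cyl b `&` cyl (rcons v false))).
  apply/seteqP; split=> [[x y] [[/= ax by_]]|[x y]] /=.
    by move=> [[/= vx vy]|[/= vx vy]]; [left|right].
  by move=> [] [[ax vx] [by_ vy]]; split=> //; [left|right].
rewrite measureU.
- rewrite (EFinD (_ * _)) !EFinM -!massE; congr (_ + _)%E.
  + by apply: product_measure1E; exact: measurableI.
  + by apply: product_measure1E; exact: measurableI.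
- by apply: measurableX; exact: measurableI.
- by apply: measurableX; exact: measurableI.
- apply/seteqP; split=> // -[x y] [[/= [_ x0] _] [/= [_ x1] _]].
  by have : (cyl (rcons v false) `&` cyl (rcons v true)) x by []; rewrite rcons_disj.
Qed.

Let mass_nil v b : mass v b [::] = 2 ^- (size v).+1.
Proof.
apply: EFin_inj; rewrite -massE (_ : _ `&` _ = cyl (rcons v b)).
  by rewrite mu_cantor size_rcons.
by apply/seteqP; split=> [x []|x xv]//; split.
Qed.

(** The set [Upsilon_v] has measure [2 * 4^-(size v + 1)], whence the factor. *)
Let nu_pair v a b : nu_at mu v (cyl a `*` cyl b) =
  (mass v false a * mass v true b + mass v true a * mass v false b) *
  (2 * 4 ^+ size v).
Proof.
rewrite /nu_at prod_pair/=; congr (_ * _).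
have -> : Upsilon_at v = (cyl [::] `*` cyl [::]) `&` Upsilon_at v.
  by apply/seteqP; split=> [x vx|x []//]; split.
rewrite prod_pair/= !mass_nil (_ : 4 = 2 ^+ 2); last by rewrite expr2; ring.
rewrite -exprM mulnC exprM !exprS; field.
by rewrite expf_neq0.
Qed.

Let event v a b : set (Upsilon R) :=
  [set tau | cyl a (sval tau v).1 /\ cyl b (sval tau v).2].

Let measurable_event v a b : measurable (event v a b).
Proof.
apply: sub_sigma_algebra; exists v, (cyl a `*` cyl b); split=> //.
by apply: measurableX; exact: measurable_cyl.
Qed.

Let nu_event v a b : fine (nu (event v a b)) =
  (mass v false a * mass v true b + mass v true a * mass v false b) *
  (2 * 4 ^+ size v).
Proof.
rewrite -nu_pair.
have := @nu_product [:: v] (fun=> cyl a `*` cyl b) isT.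
rewrite big_seq1 => <-; last first.
  by move=> _; apply: measurableX; exact: measurable_cyl.
congr (fine (nu _)); apply/seteqP; split=> tau /=.
  by move=> [ta tb] u; rewrite inE => /eqP ->.
by move/(_ v); rewrite inE eqxx => /(_ isT).
Qed.

Let tupleX n := (n.-tuple bool * n.-tuple bool)%type.

Let pair_weight n (F G : n.-tuple bool -> R) (p : tupleX n) : R :=
  (F p.1 - F p.2) * (G p.1 - G p.2).

Let jump_sum n (F G : n.-tuple bool -> R) (f g : C3 -> R) tau v :
  (forall x, f x = F (word n x)) -> (forall x, g x = G (word n x)) ->
  jump f tau v * jump g tau v =
  \sum_(p : tupleX n) pair_weight F G p * \1_(event v p.1 p.2) tau.
Proof.
move=> fF gG; set x := (sval tau v).1; set y := (sval tau v).2.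
have cyl_word (z : C3) (a : n.-tuple bool) : cyl a z <-> a = word n z.
  rewrite /cyl /mkset size_tuple; split=> [za|->//].
  by apply: val_inj; rewrite /= za.
rewrite (bigD1 (word n x, word n y))// big1; last first.
  move=> [a b] ab; rewrite indicE memNset ?mulr0// => -[/cyl_word/= ax /cyl_word/= by_].
  by move: ab; rewrite ax by_ eqxx.
have xy : event v (word n x) (word n y) tau.
  by split; [exact: (cyl_word x _).2|exact: (cyl_word y _).2].
apply: etrans (esym (addr0 _)).
by rewrite indicE (mem_set xy) mulr1 /jump -/x -/y !fF !gG.
Qed.

Let jump_integrable n (F G : n.-tuple bool -> R) (f g : C3 -> R) v :
  (forall x, f x = F (word n x)) -> (forall x, g x = G (word n x)) ->
  nu.-integrable [set: Upsilon R] (EFin \o (fun tau => jump f tau v * jump g tau v)).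
Proof.
move=> fF gG; have -> : (fun tau : Upsilon R => jump f tau v * jump g tau v) =
    fun tau => \sum_(p : tupleX n) pair_weight F G p * \1_(event v p.1 p.2) tau.
  by apply/funext => tau; exact: jump_sum.
by apply: integrable_sum_indic.
Qed.

(** Fubini for the measure [m0 x m1 + m1 x m0] on a finite square. *)
Lemma symmetrized_sum (J : finType) (F G m0 m1 : J -> R) :
  \sum_(p : J * J) (F p.1 - F p.2) * (G p.1 - G p.2) *
     (m0 p.1 * m1 p.2 + m1 p.1 * m0 p.2) =
  2 * ((\sum_a F a * G a * m0 a) * (\sum_a m1 a) +
       (\sum_a F a * G a * m1 a) * (\sum_a m0 a) -
       (\sum_a F a * m0 a) * (\sum_a G a * m1 a) -
       (\sum_a F a * m1 a) * (\sum_a G a * m0 a)).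
Proof.
rewrite -(pair_bigA _ (fun a b => (F a - F b) * (G a - G b) * (m0 a * m1 b + m1 a * m0 b)))/=.
rewrite mulr_natl mulr2n.
rewrite [X in _ = X + _](_ : _ = (\sum_a F a * G a * m0 a) * (\sum_a m1 a) +
   (\sum_a F a * G a * m1 a) * (\sum_a m0 a) -
   (\sum_a F a * m0 a) * (\sum_a G a * m1 a) -
   (\sum_a F a * m1 a) * (\sum_a G a * m0 a))//.
rewrite [X in _ = _ + X](_ : _ = (\sum_a m1 a) * (\sum_a F a * G a * m0 a) +
   (\sum_a m0 a) * (\sum_a F a * G a * m1 a) -
   (\sum_a G a * m1 a) * (\sum_a F a * m0 a) -
   (\sum_a G a * m0 a) * (\sum_a F a * m1 a)); last by ring.
rewrite !big_distrlr/= -!sumrN -!big_split/=; apply: eq_bigr => a _.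
rewrite -!sumrN -!big_split/=; apply: eq_bigr => b _; ring.
Qed.

Let sum_chiL2 n (F : n.-tuple bool -> R) (f : L2 mu) :
  (forall x, f x = F (word n x)) -> f = \sum_a F a *: chiL2 mu a.
Proof.
by move=> fF; apply/LfuneqP => x; rewrite L2_sumE fF -sum_chi.
Qed.

Let chi_nil_sum n : chiL2 mu [::] = \sum_(a : n.-tuple bool) chiL2 mu a.
Proof.
rewrite (eq_bigr (fun a : n.-tuple bool => 1 *: chiL2 mu a)); last first.
  by move=> a _; rewrite scale1r.
by apply: sum_chiL2 => x; rewrite -[LHS]/(chi R [::] x) chiE eqxx.
Qed.

(** The two ends are independent and uniform on the two halves of the cylinder of
    [v], which are exchanged with probability [1/2]. Up to the factor
    [2^(size v + 1)], the inner products are means over the halves. *)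
Let int_jump n (F G : n.-tuple bool -> R) (f g h : L2 mu) v :
  (forall x, f x = F (word n x)) -> (forall x, g x = G (word n x)) ->
  (forall x, h x = f x * g x) ->
  \int[nu]_tau (jump f tau v * jump g tau v) =
  2 ^+ (size v).+1 * (dotL2 h (chiL2 mu (rcons v false)) + dotL2 h (chiL2 mu (rcons v true)))
  - 4 ^+ (size v).+1 *
    (dotL2 f (chiL2 mu (rcons v false)) * dotL2 g (chiL2 mu (rcons v true)) +
     dotL2 f (chiL2 mu (rcons v true)) * dotL2 g (chiL2 mu (rcons v false))).
Proof.
move=> fF gG hfg.
have hFG x : h x = F (word n x) * G (word n x) by rewrite hfg fF gG.
have dotE (k : L2 mu) K b : (forall x, k x = K (word n x)) ->
    dotL2 k (chiL2 mu (rcons v b)) = \sum_(a : n.-tuple bool) K a * mass v b a.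
  move=> /sum_chiL2 ->; rewrite dotL2_suml; apply: eq_bigr => a _.
  by rewrite dotL2Zl.
have mass1 b : \sum_(a : n.-tuple bool) mass v b a = 2 ^- (size v).+1.
  rewrite -[RHS](mass_nil v b) /mass (chi_nil_sum n) dotL2_suml; by [].
under eq_Rintegral do rewrite (jump_sum _ _ fF gG).
rewrite Rintegral_sum_indic// (eq_bigr (fun p : tupleX n => (F p.1 - F p.2) * (G p.1 - G p.2) *
    (mass v false p.1 * mass v true p.2 + mass v true p.1 * mass v false p.2) *
    (2 * 4 ^+ size v))); last by move=> p _; rewrite nu_event mulrA.
rewrite -mulr_suml (symmetrized_sum F G
  (fun a : n.-tuple bool => mass v false a) (fun a : n.-tuple bool => mass v true a)).
rewrite !mass1 -!(dotE _ _ _ fF) -!(dotE _ _ _ gG).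
rewrite -!(dotE h (fun a => F a * G a) _ hFG).
rewrite (_ : 4 = 2 ^+ 2); last by rewrite expr2; ring.
rewrite -!exprM ![(2 * _)%N]mulnC !exprM !exprS; field.
by rewrite expf_neq0.
Qed.

Lemma sum_tuple_rcons k (H : seq bool -> R) :
  \sum_(u : k.+1.-tuple bool) H u =
  \sum_(v : k.-tuple bool) (H (rcons v false) + H (rcons v true)).
Proof.
rewrite (eq_bigr (fun v : k.-tuple bool => \sum_(b : bool) H (rcons v b))); last first.
  by move=> v _; rewrite big_bool addrC.
rewrite pair_bigA/=.
rewrite (reindex (fun p : k.-tuple bool * bool => [tuple of rcons p.1 p.2]))//=.
exists (fun u : k.+1.-tuple bool => (word k (nth false u), nth false u k)).
  move=> [v b] _; congr pair; last by rewrite /= nth_rcons size_tuple ltnn eqxx.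
  apply: val_inj; apply: (@eq_from_nth _ false); rewrite size_mkseq ?size_tuple//.
  by move=> i ik; rewrite nth_mkseq//= nth_rcons size_tuple ik.
move=> u _; apply: val_inj => /=; apply: (@eq_from_nth _ false).
  by rewrite size_rcons size_mkseq size_tuple.
move=> i; rewrite size_rcons size_mkseq ltnS => ik /=.
rewrite nth_rcons size_mkseq; case: ltngtP ik => // [ik|->] _; first by rewrite nth_mkseq.
by [].
Qed.

Let chi_rcons v :
  chiL2 mu v = chiL2 mu (rcons v false) + chiL2 mu (rcons v true).
Proof.
apply/LfuneqP => x; rewrite -[RHS]/(chi R _ x + chi R _ x) -[LHS]/(chi R _ x) !chiE.
have mkS k : mkseq x k.+1 = rcons (mkseq x k) (x k).
  by rewrite /mkseq -addn1 iotaD map_cat cats1.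
rewrite !size_rcons mkS !eqseq_rcons; case: eqP => _ /=; last by rewrite addr0.
by case: (x _); rewrite ?addr0 ?add0r.
Qed.

(** The part of the inner product seen at depth [k]. *)
Let level_dot k (f g : L2 mu) : R :=
  \sum_(w <- haar_level k) coef (haar mu) f w * coef (haar mu) g w.

(** The inner products with the cylinders of depth [k] are a Walsh transform of the
    coefficients, to which orthogonality of characters applies. *)
Let level_dotE k (f g : L2 mu) :
  \sum_(v : k.-tuple bool) dotL2 f (chiL2 mu v) * dotL2 g (chiL2 mu v) =
  2 ^- k * level_dot k f g.
Proof.
have dotE (h : L2 mu) (v : k.-tuple bool) : dotL2 h (chiL2 mu v) =
    2 ^- k * \sum_(t : k.-tuple bool) walsh R k (nth false t) (nth false v) *
      coef (haar mu) h (pad t).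
  rewrite chi_haar dotL2_sumr mulr_sumr; apply: eq_bigr => t _.
  by rewrite dotL2Zr mulrA.
rewrite /level_dot big_haar_level.
transitivity (\sum_(v : k.-tuple bool) \sum_(t : k.-tuple bool) \sum_(u : k.-tuple bool)
    (2 ^- k) ^+ 2 * coef (haar mu) f (pad t) * coef (haar mu) g (pad u) *
    (walsh R k (nth false v) (nth false t) * walsh R k (nth false v) (nth false u))).
  apply: eq_bigr => v _; rewrite !dotE mulrACA -expr2 big_distrlr/= mulr_sumr.
  apply: eq_bigr => t _; rewrite mulr_sumr; apply: eq_bigr => u _.
  rewrite (walshC _ _ (nth false v) (nth false t)) (walshC _ _ (nth false v) (nth false u)).
  ring.
rewrite exchange_big/= mulr_sumr; apply: eq_bigr => t _.
rewrite exchange_big/= (bigD1 t)//= [X in _ + X]big1 ?addr0 => [|u ut].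
  rewrite -mulr_sumr sum_walsh eqxx; field.
  by rewrite expf_neq0.
rewrite -mulr_sumr sum_walsh.
have mk (s : k.-tuple bool) : mkseq (nth false s) k = s.
  by rewrite -[X in mkseq _ X](size_tuple s) mkseq_nth.
by rewrite !mk val_eqE eq_sym (negbTE ut) mulr0.
Qed.

(** In [int_jump] the cross terms are what remains of the product
    [(f_0 + f_1) (g_0 + g_1)] after removing [f_0 g_0 + f_1 g_1], where [f_0 + f_1]
    is the inner product with the whole cylinder of [v]. Only sums over the
    cylinders of depths [k] and [k + 1] survive. *)
Let level_jump n (F G : n.-tuple bool -> R) (f g : L2 mu) k :
  (forall x, f x = F (word n x)) -> (forall x, g x = G (word n x)) ->
  \sum_(v : k.-tuple bool) \int[nu]_tau (jump f tau v * jump g tau v) =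
  2 ^+ k * (2 * dotL2 f g - 4 * level_dot k f g + 2 * level_dot k.+1 f g).
Proof.
move=> fF gG; pose h : L2 mu := \sum_(a : n.-tuple bool) (F a * G a) *: chiL2 mu a.
have hfg x : h x = f x * g x.
  by rewrite L2_sumE fF gG -(sum_chi (fun a => F a * G a)).
have hT : dotL2 h (chiL2 mu [::]) = dotL2 f g.
  apply: eq_Rintegral => x _; rewrite hfg -[chiL2 _ _ _]/(chi R [::] x) chiE eqxx.
  by rewrite mulr1.
rewrite (eq_bigr (fun v : k.-tuple bool => 2 ^+ k.+1 *
   (dotL2 h (chiL2 mu (rcons v false)) + dotL2 h (chiL2 mu (rcons v true)))
   - 4 ^+ k.+1 * (dotL2 f (chiL2 mu v) * dotL2 g (chiL2 mu v))
   + 4 ^+ k.+1 * (dotL2 f (chiL2 mu (rcons v false)) * dotL2 g (chiL2 mu (rcons v false)) +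
     dotL2 f (chiL2 mu (rcons v true)) * dotL2 g (chiL2 mu (rcons v true))))); last first.
  move=> v _; rewrite (int_jump _ fF gG hfg) size_tuple [chiL2 mu v]chi_rcons !dotL2Dr.
  ring.
rewrite !big_split/= sumrN -!mulr_sumr level_dotE.
rewrite -(sum_tuple_rcons _ (fun u => dotL2 f (chiL2 mu u) * dotL2 g (chiL2 mu u))).
rewrite level_dotE -(sum_tuple_rcons _ (fun u => dotL2 h (chiL2 mu u))).
rewrite -dotL2_sumr -chi_nil_sum hT.
rewrite (_ : 4 ^+ k.+1 = 2 ^+ k.+1 * 2 ^+ k.+1 :> R); last first.
  by rewrite -exprMn; congr (_ ^+ _); ring.
rewrite !exprS; field.
by rewrite expf_neq0.
Qed.

Let basis := haar_graded mu_cantor.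

Lemma cutoff_word n (f : L2 mu) : f = cutoff (haar mu) haar_level n f ->
  exists F : n.-tuple bool -> R, forall x, f x = F (word n x).
Proof.
move=> fn; exists (fun v => \sum_(t : n.-tuple bool)
  coef (haar mu) f (pad t) * walsh R n (nth false t) (nth false v)) => x.
rewrite [in LHS]fn /cutoff /combin big_haar_level L2_sumE; apply: eq_bigr => t _.
congr (_ * _); rewrite -[LHS]/(haar_fun R (pad t) x) (haar_funE _ _ (wlen_pad t)).
by apply: eq_walsh => // k kn /=; rewrite nth_mkseq.
Qed.

Lemma word_cutoff n (F : n.-tuple bool -> R) (f : L2 mu) :
  (forall x, f x = F (word n x)) -> f = cutoff (haar mu) haar_level n f.
Proof.
move=> /sum_chiL2 fE; pose c (w : haar_index) := \sum_(a : n.-tuple bool)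
  F a * (2 ^- n * walsh R n (sval w) (nth false a)).
have fc : f = combin (haar mu) haar_level c n.
  rewrite fE /combin big_haar_level /c.
  under eq_bigr do rewrite chi_haar scaler_sumr.
  rewrite exchange_big/=; apply: eq_bigr => t _; rewrite scaler_suml.
  by apply: eq_bigr => a _; rewrite scalerA.
rewrite [LHS]fc /cutoff /combin big_seq [RHS]big_seq; apply: eq_bigr => w.
rewrite mem_haar_level => wn; congr (_ *: _).
by rewrite fc (coef_combin basis) wn.
Qed.

Lemma form_domP (f : L2 mu) :
  form_dom f <-> exists n, f = cutoff (haar mu) haar_level n f.
Proof.
split=> [[m [c [v fE]]]|[n fn]].
  pose n := \max_(i < m) size (v i); exists n.
  apply: (@word_cutoff n (fun a => \sum_(i < m) c i * (take (size (v i)) a == v i)%:R)) => x.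
  rewrite fE; apply: eq_bigr => i _; rewrite chiE /= take_mkseq//.
  exact: (leq_bigmax i).
have [F fF] := cutoff_word fn.
exists #|{: n.-tuple bool}|, (fun i => F (enum_val i)), (fun i => val (enum_val i)) => x.
rewrite fF -sum_chi.
rewrite [LHS](reindex (@enum_val _ {: n.-tuple bool}))//=.
by apply: onW_bij; exact: enum_val_bij.
Qed.

Let jump_deep n (F : n.-tuple bool -> R) (f : C3 -> R) tau v :
  (forall x, f x = F (word n x)) -> (n <= size v)%N -> jump f tau v = 0.
Proof.
move=> fF nv; have [/cylP xv /cylP yv _] := svalP tau v.
rewrite /jump !fF; apply/eqP; rewrite subr_eq0; apply/eqP; congr F.
apply: val_inj; apply: (@eq_from_nth _ false); rewrite ?size_mkseq// => i iN.
by rewrite !nth_mkseq// xv ?yv// (leq_trans iN).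
Qed.

(** A Haar function of length [m] has mean [0] on the cylinders of depth less than
    [m] and is constant on those of depth at least [m]. So depth [k] contributes
    [2 r^k] for [k < m - 1], then [4 r^k] for [k = m - 1], and nothing from [m] on. *)
Lemma sum_levels_lam (s : R) n m : (m <= n)%N ->
  \sum_(k < n) Defs.ratio s ^+ k *
    (2 - 4 * ((m <= k)%N)%:R + 2 * ((m <= k.+1)%N)%:R) = lam s m.
Proof.
move=> mn; rewrite -(big_mkord xpredT (fun k => Defs.ratio s ^+ k *
    (2 - 4 * ((m <= k)%N)%:R + 2 * ((m <= k.+1)%N)%:R))).
rewrite (big_cat_nat (n := m))//= [X in _ + X]big_nat_cond [X in _ + X]big1 ?addr0; last first.
  move=> k /andP[/andP[mk kn] _]; rewrite mk leqW// mulr1 mulr1; ring.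
case: m mn => [|m] mn; first by rewrite big_geq.
rewrite big_nat_recr//= ltnn ltnSn big_mkord /lam [in RHS]mulrDr [in RHS]mulr_sumr.
congr (_ + _); last by rewrite /=; ring.
apply: eq_bigr => k _.
have -> : (m < k.+1)%N = false by rewrite ltnS leqNgt ltn_ord.
have -> : (m < k)%N = false by apply/negbTE; rewrite -leqNgt ltnW.
by rewrite /=; ring.
Qed.

Lemma ratioE (s : R) : Defs.ratio s = 2 * 3 `^ (2 - s).
Proof.
rewrite /Defs.ratio -addrA powRD; last by rewrite pnatr_eq0 implybT.
congr (_ * _); rewrite /s0 /powR pnatr_eq0/= divfK ?lnK ?posrE//.
by rewrite gt_eqF// ln_gt0// ltr1n.
Qed.

(** Functions of the first [n] letters do not jump at vertices of height at least
    [n], which makes the trace a finite sum; [level_jump] and [sum_levels_lam]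
    evaluate it. *)
Lemma Qform_diag (s : R) (f g : L2 mu) n :
  f = cutoff (haar mu) haar_level n f -> g = cutoff (haar mu) haar_level n g ->
  Qform nu s f g = \sum_(w <- haar_level n)
    lam s (wlen w) * coef (haar mu) f w * coef (haar mu) g w.
Proof.
move=> fn gn; have [F fF] := cutoff_word fn; have [G gG] := cutoff_word gn.
have traceE (tau : Upsilon R) : btrace (bmul (absD_pow (- s))
    (bmul (badj (bcomm (@dirac_op R) (pi_rep tau f))) (bcomm (@dirac_op R) (pi_rep tau g)))) =
    \sum_(k < n) \sum_(v : k.-tuple bool)
      2 * (3 `^ (2 - s)) ^+ k * (jump f tau v * jump g tau v).
  apply: lim_near_cst => //; exists n => // N /= nN.
  under eq_bigr => k _ do under eq_bigr => v _ do rewrite block_trace size_tuple.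
  rewrite -(big_mkord xpredT (fun k => \sum_(v : k.-tuple bool)
    2 * (3 `^ (2 - s)) ^+ k * (jump f tau v * jump g tau v))).
  rewrite (big_cat_nat (n := n))//= big_mkord [X in _ + X]big_nat_cond.
  rewrite [X in _ + X]big1 ?addr0// => k /andP[/andP[nk _] _].
  by rewrite big1// => v _; rewrite (jump_deep _ fF) ?size_tuple// mul0r mulr0.
rewrite /Qform (@eq_Rintegral _ _ _ nu _ (fun tau : Upsilon R =>
    \sum_(k < n) \sum_(v : k.-tuple bool)
      2 * (3 `^ (2 - s)) ^+ k * (jump f tau v * jump g tau v))); last first.
  by move=> tau _; exact: traceE.
have intZ (k : nat) (v : k.-tuple bool) : nu.-integrable [set: Upsilon R]
    (EFin \o (fun tau => 2 * (3 `^ (2 - s)) ^+ k * (jump f tau v * jump g tau v))).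
  rewrite (_ : _ \o _ = fun tau => ((2 * (3 `^ (2 - s)) ^+ k)%:E *
    (jump f tau v * jump g tau v)%:E)%E)//.
  by apply: integrableZl => //; exact: (jump_integrable v fF gG).
rewrite Rintegral_sum; last first.
  move=> k; rewrite (_ : _ \o _ = fun tau => (\sum_(v : k.-tuple bool)
    (2 * (3 `^ (2 - s)) ^+ k * (jump f tau v * jump g tau v))%:E)%E).
    by apply: integrable_sum => // v _; exact: intZ.
  by apply/funext => tau; rewrite sumEFin.
rewrite mulr_sumr (eq_bigr (fun k : 'I_n => Defs.ratio s ^+ k *
  (2 * dotL2 f g - 4 * level_dot k f g + 2 * level_dot k.+1 f g))); last first.
  move=> k _; rewrite Rintegral_sum//.
  rewrite (eq_bigr (fun v : k.-tuple bool => 2 * (3 `^ (2 - s)) ^+ k *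
      \int[nu]_tau (jump f tau v * jump g tau v))); last first.
    by move=> v _; rewrite RintegralZl//; exact: (jump_integrable v fF gG).
  by rewrite -mulr_sumr (level_jump _ fF gG) ratioE exprMn; field.
have levelE k : (k <= n)%N -> level_dot k f g = \sum_(w <- haar_level n)
    ((wlen w <= k)%N)%:R * (coef (haar mu) f w * coef (haar mu) g w).
  move=> kn; rewrite /level_dot (big_L_widen basis _ kn).
  by rewrite big_mkcond; apply: eq_bigr => w _; case: ifP; rewrite ?mul1r ?mul0r.
have dotE : dotL2 f g = \sum_(w <- haar_level n) coef (haar mu) f w * coef (haar mu) g w.
  by rewrite [in LHS]fn /cutoff (dot_combin (haar mu)).
rewrite (eq_bigr (fun k : 'I_n => \sum_(w <- haar_level n) Defs.ratio s ^+ k *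
    (2 - 4 * ((wlen w <= k)%N)%:R + 2 * ((wlen w <= k.+1)%N)%:R) *
    (coef (haar mu) f w * coef (haar mu) g w))); last first.
  move=> k _; rewrite dotE !levelE ?(ltnW (ltn_ord k))//.
  rewrite !mulr_sumr -sumrN -!big_split/= mulr_sumr; apply: eq_bigr => w _; ring.
rewrite exchange_big/= big_seq [RHS]big_seq; apply: eq_bigr => w.
rewrite mem_haar_level => wn; rewrite -mulr_suml sum_levels_lam//; ring.
Qed.

End Form.

(** * The eigenvalues and their growth *)

Section Eigenvalues.
Variable R : realType.
Implicit Types (s l : R).

Lemma powR3_eq1 (x : R) : (3 `^ x == 1) = (x == 0).
Proof.
by rewrite powR_eq1 ltNge ler0n pnatr_eq1.
Qed.

Lemma powR3_gt1 (x : R) : 0 < x -> 1 < 3 `^ x.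
Proof.
move=> x0; have := ler_powR (ler1n R 3) (ltW x0); rewrite powRr0 le_eqVlt.
by rewrite eq_sym powR3_eq1 gt_eqF.
Qed.

Lemma s0_gt0 : 0 < s0 R.
Proof. by rewrite divr_gt0 ?ln_gt0// ltr1n. Qed.

Lemma powR3_s0 : 3 `^ s0 R = 2 :> R.
Proof.
rewrite /s0 /powR pnatr_eq0/= divfK ?lnK ?posrE//.
by rewrite gt_eqF// ln_gt0// ltr1n.
Qed.

Lemma ratio_gt0 s : 0 < Defs.ratio s.
Proof. by rewrite powR_gt0. Qed.

Lemma ratio_gt1 s : s < s0 R + 2 -> 1 < Defs.ratio s.
Proof. by move=> s2; apply: powR3_gt1; rewrite subr_gt0. Qed.

Lemma ratio_ge1 s : s <= s0 R + 2 -> 1 <= Defs.ratio s.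
Proof.
rewrite le_eqVlt => /predU1P[->|/ratio_gt1/ltW//].
by rewrite /Defs.ratio subrr powRr0.
Qed.

Lemma ratio_lt1 s : s0 R + 2 < s -> Defs.ratio s < 1.
Proof.
move=> s2; rewrite /Defs.ratio -[_ - s]opprK powRN -[ltRHS]invr1.
rewrite ltf_pV2 ?posrE ?powR_gt0//; apply: powR3_gt1.
by rewrite opprB subr_gt0.
Qed.

Lemma ratio_neq_half s : s <> 2 + 2 * s0 R -> 2 * Defs.ratio s != 1.
Proof.
move=> s2; rewrite /Defs.ratio -{1}powR3_s0 -powRD; last by rewrite pnatr_eq0 implybT.
by rewrite powR3_eq1; apply/eqP => h; apply: s2; lra.
Qed.

Lemma lam_gt0 s n : 0 < lam s n.+1.
Proof.
have r0 := ratio_gt0 s.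
rewrite /lam mulr_gt0// ltr_wpDl ?mulr_gt0 ?exprn_gt0//.
by apply: sumr_ge0 => i _; rewrite exprn_ge0// ltW.
Qed.

Lemma lam_ge0 s n : 0 <= lam s n.
Proof. by case: n => [|n]; [exact: lexx|exact/ltW/lam_gt0]. Qed.

Lemma lamS s n : lam s n.+2 = lam s n.+1 + 2 * Defs.ratio s ^+ n * (2 * Defs.ratio s - 1).
Proof. by rewrite /lam big_ord_recr/= exprS; ring. Qed.

Lemma lam_lt s : 1 < 2 * Defs.ratio s -> {homo lam s : m n / (m < n)%N >-> m < n}.
Proof.
move=> r2; apply: (homo_ltn lt_trans) => -[|n]; first exact: lam_gt0.
by rewrite lamS ltrDl mulr_gt0 ?subr_gt0// mulr_gt0// exprn_gt0// ratio_gt0.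
Qed.

Lemma lam_gt s : 2 * Defs.ratio s < 1 ->
  {homo (fun n => - lam s n.+1) : m n / (m < n)%N >-> m < n}.
Proof.
move=> r2; apply: (homo_ltn lt_trans) => n.
rewrite ltrN2 lamS gtrDl pmulr_rlt0 ?subr_lt0//.
by rewrite mulr_gt0// exprn_gt0// ratio_gt0.
Qed.

(** The increments of the eigenvalues have the sign of [2 r - 1]. *)
Lemma lam_inj s : s <> 2 + 2 * s0 R -> injective (lam s).
Proof.
move=> /ratio_neq_half; rewrite neq_lt => /orP[r2|r2] m n.
  case: m n => [|m] [|n] //.
  - by move/eqP; rewrite lt_eqF// lam_gt0.
  - by move/eqP; rewrite gt_eqF// lam_gt0.
  - move=> /(congr1 -%R) mn; have [mn'|nm|->//] := ltngtP m n.
      by have := lam_gt r2 mn'; rewrite mn ltxx.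
    by have := lam_gt r2 nm; rewrite mn ltxx.
move=> mn; have [mn'|nm|//] := ltngtP m n.
  by have := lam_lt r2 mn'; rewrite mn ltxx.
by have := lam_lt r2 nm; rewrite mn ltxx.
Qed.

Lemma lamE s n : Defs.ratio s != 1 ->
  lam s n.+1 = 2 / (1 - Defs.ratio s) +
    Defs.ratio s ^+ n * (4 - 2 / (1 - Defs.ratio s)).
Proof.
move=> r1; have r1' : 1 - Defs.ratio s != 0 by rewrite subr_eq0 eq_sym.
elim: n => [|n IH]; first by rewrite /lam big_ord0 expr0; field.
by rewrite lamS IH exprS; field.
Qed.

Lemma lam_near s (eps : R) : s0 R + 2 < s -> 0 < eps ->
  exists N, forall n, (N < n)%N -> `|2 / (1 - Defs.ratio s) - lam s n| <= eps.
Proof.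
move=> s2 eps0; have r1 := ratio_lt1 s2; have r0 := ratio_gt0 s.
set c := 4 - 2 / (1 - Defs.ratio s).
have : (fun n => Defs.ratio s ^+ n * c) @ \oo --> (0 : R).
  rewrite -(mul0r c); apply: cvgM; last exact: cvg_cst.
  by apply: cvg_expr; rewrite gtr0_norm.
move=> /cvgrPdist_le/(_ _ eps0)[N _ HN]; exists N => -[//|n] Nn.
rewrite lamE ?lt_eqF// -/c opprD addrA subrr; exact: HN.
Qed.

Lemma lam_pinfty s (B : R) : s <= s0 R + 2 -> exists N, forall n, (N < n)%N -> B <= lam s n.
Proof.
move=> /ratio_ge1 r1; have [N BN] : exists N, B <= N%:R.
  exists (Num.truncn `|B|).+1; apply: le_trans (ler_norm B) (ltW (truncnS_gt _)).
exists N => -[//|n]; rewrite ltnS => Nn; apply: le_trans BN _.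
apply: (@le_trans _ _ n%:R); first by rewrite ler_nat.
have rn i : 1 <= Defs.ratio s ^+ i by rewrite exprn_ege1.
have : n%:R <= \sum_(i < n) Defs.ratio s ^+ i.
  by rewrite -[n in n%:R]card_ord -sumr_const; apply: ler_sum => i _; exact: rn.
by have := rn n; have := ler0n R n; rewrite /lam; lra.
Qed.

Section Growth.
Variable s : R.
Hypothesis s_lt : s < s0 R + 2.

Let r := Defs.ratio s.
Let p := s0 R / (2 + s0 R - s).
Let k := dos_const s.

Let r_gt1 : 1 < r. Proof. exact: ratio_gt1. Qed.
Let r_gt0 : 0 < r. Proof. exact: ratio_gt0. Qed.

Let p_gt0 : 0 < p.
Proof. by rewrite divr_gt0 ?s0_gt0// subr_gt0 addrC. Qed.

Let rp : r `^ p = 2.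
Proof.
rewrite /r /Defs.ratio -powRrM /p mulrC [s0 R + 2]addrC divfK ?powR3_s0//.
by rewrite gt_eqF// subr_gt0 addrC.
Qed.

Let kE : k = (2 * r - 1) / (r - 1).
Proof.
rewrite /k /dos_const (_ : s - 2 - s0 R = - (s0 R + 2 - s)); last by ring.
rewrite powRN -/(Defs.ratio s) -/r; field.
have r0 : r != 0 by rewrite gt_eqF.
have r1 : r - 1 != 0 by rewrite subr_eq0 gt_eqF.
by apply/andP; split => //.
Qed.

Let k_gt0 : 0 < k.
Proof. by rewrite kE divr_gt0 ?subr_gt0//; have := r_gt1; lra. Qed.

Lemma lam_lt_growth : {homo lam s : m n / (m < n)%N >-> m < n}.
Proof. by apply: lam_lt; have := r_gt1; rewrite /r; lra. Qed.

(** The eigenvalue [lam n.+1] relative to its leading term [2 k r^n]. *)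
Definition relative_lam n : R := lam s n.+1 / (2 * k * r ^+ n).

Lemma relative_lamE n : relative_lam n = 1 - (2 * r - 1)^-1 * (r^-1) ^+ n.
Proof.
have r1 : 1 - r != 0 by rewrite subr_eq0 lt_eqF.
rewrite /relative_lam lamE ?gt_eqF// kE exprVn -/r; field.
have r2 : 2 * r - 1 != 0 by have := r_gt1 => ?; rewrite gt_eqF//; lra.
have r3 : r - 1 != 0 by rewrite subr_eq0 gt_eqF.
by rewrite r1 r2 r3 expf_neq0 ?gt_eqF.
Qed.

Lemma cvg_relative_lam : (fun n => relative_lam n `^ p) @ \oo --> (1 : R).
Proof.
have c1 : (fun n => relative_lam n) @ \oo --> (1 : R).
  rewrite (_ : (fun n => _) = fun n => 1 - (2 * r - 1)^-1 * (r^-1) ^+ n); last first.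
    by apply/funext => n; exact: relative_lamE.
  rewrite -[X in _ --> X](subr0 1) -(mulr0 (2 * r - 1)^-1).
  apply: cvgB; first exact: cvg_cst.
  apply: cvgM; first exact: cvg_cst.
  by apply: cvg_expr; rewrite gtr0_norm ?invr_gt0// invf_lt1.
have /derivable1_diffP/differentiable_continuous cp : derivable (@powR R ^~ p) 1 1.
  by apply: derivable_powR; rewrite in_itv/= ltr01.
have := cvg_comp _ _ c1 cp; rewrite (_ : 1 `^ p = 1); first exact.
by rewrite powR1.
Qed.

Lemma relative_lam_gt0 n : 0 < relative_lam n.
Proof. by rewrite divr_gt0 ?lam_gt0// !mulr_gt0// exprn_gt0. Qed.

Lemma relative_lam_le1 n : relative_lam n <= 1.
Proof.
have r2 : 0 < 2 * r - 1 by have := r_gt1; lra.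
by rewrite relative_lamE gerBl mulr_ge0 ?invr_ge0 ?exprn_ge0 ?invr_ge0// ltW.
Qed.

(** The exponent [p] of the asymptotics satisfies [r^p = 2], so it turns the leading
    term [r^n] into [2^n]. *)
Lemma dos_lam n : dos_asymptotics s (lam s n.+1) = 2 ^+ n.+1 * relative_lam n `^ p.
Proof.
have rn : 0 < r ^+ n by rewrite exprn_gt0.
rewrite /dos_asymptotics -/p -/k (_ : lam s n.+1 / (2 * k) = r ^+ n * relative_lam n).
  rewrite powRM ?(ltW rn) ?(ltW (relative_lam_gt0 n))// -powR_mulrn ?(ltW r_gt0)//.
  by rewrite powRAC rp powR_mulrn// exprS mulrA.
by rewrite /relative_lam; field; rewrite !gt_eqF.
Qed.

Lemma dos_mono l l' : 0 <= l -> l <= l' -> dos_asymptotics s l <= dos_asymptotics s l'.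
Proof.
move=> l0 ll'; rewrite /dos_asymptotics -/p -/k ler_wpM2l//.
have k2 : 0 <= (2 * k)^-1 by rewrite invr_ge0 mulr_ge0// ltW.
apply: ge0_ler_powR; rewrite ?nnegrE ?(ltW p_gt0)//.
- by rewrite mulr_ge0.
- by rewrite mulr_ge0// (le_trans l0).
- by rewrite ler_wpM2r.
Qed.

Lemma dos_relative_near (eps : R) : 0 < eps ->
  exists N, forall n, (N <= n)%N -> 1 - eps < relative_lam n `^ p <= 1.
Proof.
move=> eps0; have /cvgrPdist_lt/(_ _ eps0)[N _ HN] := cvg_relative_lam.
exists N => n Nn; have x1 : relative_lam n `^ p <= 1.
  have -> : 1 = 1 `^ p by rewrite powR1.
  apply: ge0_ler_powR; rewrite ?nnegrE ?(ltW p_gt0)//.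
    exact/ltW/relative_lam_gt0.
  exact: relative_lam_le1.
have := HN n Nn; rewrite /= x1 ger0_norm ?subr_ge0// => h.
by rewrite andbT; lra.
Qed.

Lemma level_exists l : 0 <= l -> exists n, lam s n <= l < lam s n.+1.
Proof.
move=> l0; have [N HN] := lam_pinfty (l + 1) (ltW s_lt).
have ex : exists n, lam s n <= l by exists 0%N.
have bd n : lam s n <= l -> (n <= N)%N.
  by move=> nl; rewrite leqNgt; apply/negP => /HN; lra.
case: (ex_maxnP ex bd) => n nl nmax; exists n; rewrite nl/= ltNge.
by apply/negP => H; have := nmax n.+1 H; rewrite ltnn.
Qed.

End Growth.
End Eigenvalues.

(** * Spectrum of the Laplacian *)

Lemma wlen_pad_rcons m (t : m.-tuple bool) : wlen (pad (rcons_tuple t true)) = m.+1.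
Proof.
apply/eqP; rewrite eqn_leq wlen_pad /= ltnNge; apply/negP => /wlen_leP/(_ m (leqnn m)).
by rewrite /= nth_rcons size_tuple ltnn eqxx.
Qed.

Lemma wlen_eqS m (w : haar_index) :
  wlen w = m.+1 -> exists t : m.-tuple bool, w = pad (rcons_tuple t true).
Proof.
move=> wm; have wle : (wlen w <= m.+1)%N by rewrite wm.
exists (word m (sval w)); apply/haar_index_eqP => k /=.
rewrite nth_rcons size_mkseq; case: ltngtP => [km|mk|->].
- by rewrite nth_mkseq.
- exact: (wlen_leP _ _ wle).
- by have := (wlenP w).1; rewrite wm; exact.
Qed.

Lemma wlen_surj n : exists w, wlen w = n.
Proof.
case: n => [|n].
  by exists (pad [tuple]); apply/eqP; rewrite -leqn0 wlen_pad.
by exists (pad (rcons_tuple [tuple of nseq n false] true)); exact: wlen_pad_rcons.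
Qed.

Lemma wlen_eq0 (w : haar_index) : wlen w = 0%N -> w = pad [tuple].
Proof.
move=> w0; apply/haar_index_eqP => k /=; rewrite nth_nil.
by apply: (wlen_leP _ 0 _); rewrite // w0.
Qed.

Lemma card_word n : #|{: n.-tuple bool}| = (2 ^ n)%N.
Proof. by rewrite card_tuple card_bool. Qed.

Section Spectrum.
Variables (R : realType) (mu : probability C3 R) (nu : probability (Upsilon R) R) (s : R).
Hypothesis mu_cantor : is_cantor_measure mu.
Hypothesis nu_product : is_product_measure mu nu.

Let basis := haar_graded mu_cantor.
Let k w := - lam s (wlen w).

Lemma Delta_diag : Delta mu nu s = diag_op (haar mu) k.
Proof.
apply: (form_operator_diag basis).
- by move=> w; exact: lam_ge0.
- exact: form_domP.
- by move=> f g n; exact: Qform_diag.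
Qed.

Let eigenspaceP a :
  op_eigenspace (Delta mu nu s) a = [set f | forall w, k w <> a -> coef (haar mu) f w = 0].
Proof. by rewrite Delta_diag diag_eigenspaceP. Qed.

Lemma Delta_eigenvalueP a : op_eigenvalue (Delta mu nu s) a <-> exists n, a = - lam s n.
Proof.
rewrite Delta_diag (diag_eigenvalueP basis).
split=> [[w <-]|[n ->]]; first by exists (wlen w).
by have [w wn] := wlen_surj n; exists w; rewrite /k wn.
Qed.

Let dim_coef := has_dim_coef basis.

Lemma dim_ground : has_dim (op_eigenspace (Delta mu nu s) (- lam s 0)) 1.
Proof.
rewrite eigenspaceP.
apply: (dim_coef (iota := fun=> pad [tuple]) card_unit); first by move=> [] [].
  move=> _ w kw; rewrite (coef_basis basis); case: eqP => // w0; case: kw.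
  by rewrite /k -w0; congr (- lam s _); apply/eqP; rewrite -leqn0 wlen_pad.
move=> f w fw wn; apply: fw; rewrite /k => /eqP; rewrite eqr_opp => /eqP.
case: (wlen w) (@wlen_eq0 w) => [w0 _|n _].
  by apply: (wn tt); exact: w0.
by move/eqP; rewrite gt_eqF// lam_gt0.
Qed.

Let dim_level_aux n (S : set (L2 mu)) : (1 <= n)%N ->
  (forall w, wlen w = n -> S (haar mu w)) ->
  (forall f w, S f -> wlen w <> n -> coef (haar mu) f w = 0) ->
  has_dim S (2 ^ n.-1).
Proof.
case: n => // n _ Sn S0 /=.
apply: (dim_coef (iota := fun t : n.-tuple bool => pad (rcons_tuple t true)) (card_word n)).
- by move=> t t' /pad_inj/(congr1 val)/= /rcons_inj[/val_inj].
- by move=> t; apply: Sn; exact: wlen_pad_rcons.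
- move=> f w Sf wn; apply: S0 Sf _ => /wlen_eqS[t wt]; exact: wn wt.
Qed.

Lemma dim_haar_level n : (1 <= n)%N ->
  has_dim (linear_span [set haar mu w | w in [set w | wlen w = n]]) (2 ^ n.-1).
Proof.
move=> n1; apply: dim_level_aux => // [w wn|f w [m [c [v [Sv ->]]]] wn].
  have := @linear_span_big _ _ _ mu [set haar mu w | w in [set w | wlen w = n]]
    unit [:: tt] (fun=> 1) (fun=> haar mu w).
  by rewrite big_seq1 scale1r; apply=> _ _; exists w.
rewrite coefL2_sum big1// => i _; rewrite coefL2Z; have [j jn <-] := Sv i.
rewrite (coef_basis basis) ; case: eqP => [jw|]; last by rewrite mulr0.
by case: wn; rewrite -jw.
Qed.

Lemma dim_eigenspace n : s <> 2 + 2 * s0 R -> (1 <= n)%N ->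
  has_dim (op_eigenspace (Delta mu nu s) (- lam s n)) (2 ^ n.-1).
Proof.
move=> s2 n1; rewrite eigenspaceP; apply: dim_level_aux => // [w wn|f w fS wn].
  move=> w' kw'; rewrite (coef_basis basis); case: eqP => // ww'; case: kw'.
  by rewrite /k -ww' wn.
by apply: fS => /oppr_inj/(lam_inj s2).
Qed.

Lemma Delta_bounded_compact : s0 R + 2 < s -> bounded_op (Delta mu nu s) /\
  exists c : R, compact_op (op_sub_scalar (Delta mu nu s) c).
Proof.
move=> s2; set c := - (2 / (1 - Defs.ratio s)).
have van : vanishing wlen (fun w => k w - c).
  move=> eps eps0; have [N HN] := lam_near s2 eps0; exists N => w /HN.
  by rewrite /k /c opprK addrC.
rewrite Delta_diag; split; last first.
  by exists c; rewrite diag_op_shift; exact: (diag_op_compact basis van).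
have [C HC] := vanishing_bounded basis van.
apply: (diag_op_bounded basis (C := C + `|c|)) => w.
by rewrite -[k w](subrK c) (le_trans (ler_normD _ _))// lerD2r.
Qed.

Lemma Delta_compact_resolvent : s <= s0 R + 2 -> compact_resolvent (Delta mu nu s).
Proof.
move=> s2; rewrite Delta_diag.
apply: (diag_compact_resolvent basis).
  by move=> w; rewrite oppr_le0 lam_ge0.
move=> B; have [N HN] := lam_pinfty B s2; exists N => w /HN.
by rewrite /k lerN2.
Qed.

Section Growth.
Hypothesis s_lt : s < s0 R + 2.

(** The eigenvalues increase with the length, so those up to [l] belong to the Haar
    functions of length at most [n], which are indexed by the words of length [n]. *)
Lemma dim_spectral_space l : exists N,
  has_dim (spectral_space (Delta mu nu s) l) N /\
  (forall n, lam s n <= l < lam s n.+1 -> N = (2 ^ n)%N).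
Proof.
have mono m n : (m <= n)%N -> lam s m <= lam s n.
  rewrite leq_eqVlt => /predU1P[->//|mn]; exact/ltW/(lam_lt_growth s_lt).
rewrite Delta_diag (diag_spectral_spaceP basis).
have kE w : `|k w| = lam s (wlen w) by rewrite normrN ger0_norm// lam_ge0.
have [l0|l0] := leP 0 l.
  have [n /andP[nl ln]] := level_exists s_lt l0.
  exists (2 ^ n)%N; split.
    apply: (dim_coef (iota := @pad n) (card_word n)).
    - exact: pad_inj.
    - move=> t w kw; rewrite (coef_basis basis); case: eqP => // tw; case: kw.
      by rewrite kE -tw (le_trans (mono _ _ (wlen_pad t))).
    - move=> f w fS wn; apply: fS; rewrite kE => wl.
      have [wn'|nw] := leqP (wlen w) n.
        by have [t wt] := pad_onto wn'; exact: wn wt.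
      by have := lt_le_trans ln (le_trans (mono _ _ nw) wl); rewrite ltxx.
  move=> m /andP[ml lm]; congr (_ ^ _)%N; apply/eqP; rewrite eqn_leq.
  apply/andP; split; rewrite leqNgt; apply/negP => /mono h.
    by have := lt_le_trans lm (le_trans h nl); rewrite ltxx.
  by have := lt_le_trans ln (le_trans h ml); rewrite ltxx.
exists 0%N; split; last first.
  by move=> n /andP[nl _]; have := le_lt_trans (le_trans (lam_ge0 s n) nl) l0; rewrite ltxx.
apply: (dim_coef (iota := fun i : 'I_0 => pad [tuple]) (card_ord 0)).
- by move=> [].
- by move=> [].
- move=> f w fS _; apply: fS; rewrite kE => wl.
  by have := le_lt_trans (le_trans (lam_ge0 s _) wl) l0; rewrite ltxx.
Qed.

(** For [lam n.+1 <= l < lam n.+2] the counting function is [2^(n+1)], while the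
    asymptotic formula increases from [2^(n+1)] to [2^(n+2)] up to factors tending
    to [1]. *)
Lemma density_of_states : exists N : R -> nat,
  [/\ forall l, has_dim (spectral_space (Delta mu nu s) l) (N l),
      (N l)%:R / dos_asymptotics s l
        @[l --> within [set `|a| | a in op_eigenvalue (Delta mu nu s)] +oo%R]
        --> (1 : R) &
      forall e : R, 0 < e -> \forall l \near +oo%R,
        (2^-1 - e) * dos_asymptotics s l <= (N l)%:R
          <= (1 + e) * dos_asymptotics s l].
Proof.
have /choice[N HN] := dim_spectral_space.
have mono := lam_lt_growth s_lt.
have lt_inv m n : lam s m < lam s n -> (m < n)%N.
  move=> mn; rewrite ltnNge; apply/negP; rewrite leq_eqVlt => /predU1P[nm|/mono nm].
    by move: mn; rewrite nm ltxx.
  by have := lt_trans mn nm; rewrite ltxx.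
have level l n0 : lam s n0.+1 < l ->
    exists n, [/\ (n0 <= n)%N, lam s n.+1 <= l & l < lam s n.+2].
  move=> nl; have l0 : 0 <= l by exact/ltW/(le_lt_trans (lam_ge0 s n0.+1)).
  have [n /andP[n1 n2]] := level_exists s_lt l0.
  have := lt_inv _ _ (lt_trans nl n2).
  by case: n n1 n2 => // n n1 n2; rewrite !ltnS => n0n; exists n.
(* The margin [eps / (1 + eps)] is chosen for [1 / (1 - margin)] to be [1 + eps]. *)
have excess (eps x : R) : 0 < eps -> 1 - eps / (1 + eps) < x -> 1 < (1 + eps) * x.
  move=> eps0; have e1 : 0 < 1 + eps by rewrite addr_gt0.
  rewrite (_ : 1 - _ = (1 + eps)^-1); last by field; rewrite gt_eqF.
  by move=> ex; rewrite -[ltLHS](@mulfV _ (1 + eps)) ?gt_eqF// ltr_pM2l.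
exists N; split.
- by move=> l; have [] := HN l.
- apply/cvgrPdist_lt => eps eps0.
  have e1 : 0 < eps / (1 + eps) by rewrite divr_gt0// addr_gt0.
  have [n0 Hn0] := dos_relative_near s_lt e1.
  exists (lam s n0.+1); split; first exact: num_real.
  move=> l nl [a /Delta_eigenvalueP[m ->]]; rewrite normrN ger0_norm ?lam_ge0// => lE.
  have [n [n0n nl' ln]] := level _ _ nl.
  have -> : N l = (2 ^ n.+1)%N by apply: (HN l).2; rewrite nl'.
  have mn : m = n.+1.
    have m2 : (m < n.+2)%N by apply: lt_inv; rewrite lE.
    apply/eqP; rewrite eqn_leq -ltnS m2/= leqNgt.
    by apply/negP => /mono; rewrite lE ltNge nl'.
  rewrite -lE mn.
  have /andP[x0 x1] := Hn0 n n0n.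
  rewrite dos_lam// natrX.
  have {x0} := excess _ _ eps0 x0; move: (relative_lam s n `^ _) x1 => x x1 x0.
  have xgt0 : 0 < x by rewrite -(pmulr_rgt0 x (_ : 0 < 1 + eps)) ?addr_gt0// (lt_trans ltr01).
  rewrite (_ : 1 - _ = - ((1 - x) / x)); last first.
    by field; rewrite expf_neq0 ?gt_eqF.
  rewrite normrN ger0_norm ?divr_ge0 ?subr_ge0 ?(ltW xgt0)//.
  by rewrite ltr_pdivrMr//; lra.
- move=> eps eps0.
  have e1 : 0 < eps / (1 + eps) by rewrite divr_gt0// addr_gt0.
  have [n0 Hn0] := dos_relative_near s_lt e1.
  exists (lam s n0.+1); split; first exact: num_real.
  move=> l nl; have [n [n0n nl' ln]] := level _ _ nl.
  have -> : N l = (2 ^ n.+1)%N by apply: (HN l).2; rewrite nl'.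
  have l0 : 0 <= l by exact: le_trans (lam_ge0 s _) nl'.
  have lo := dos_mono s_lt (lam_ge0 s _) nl'.
  have hi := dos_mono s_lt l0 (ltW ln).
  have /andP[x0 x1] := Hn0 n n0n.
  have /andP[_ y1] := Hn0 n.+1 (leqW n0n).
  have {x0} := excess _ _ eps0 x0; move: lo hi; rewrite !dos_lam// natrX (exprS _ n.+1).
  move: (dos_asymptotics s l) (relative_lam s n `^ _) (relative_lam s n.+1 `^ _) x1 y1.
  move=> A x y x1 y1; have : 0 < (2 : R) ^+ n.+1 by rewrite exprn_gt0.
  move: (2 ^+ n.+1) => P P0 lo hi xe; have xgt0 : 0 < x by nra.
  have A0 : 0 < A by apply: lt_le_trans lo; rewrite mulr_gt0.
  have A2 : A <= 2 * P by apply: le_trans hi _; rewrite ler_piMr// mulr_ge0// ltW.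
  have eA : 0 <= eps * A by rewrite mulr_ge0// ltW.
  apply/andP; split; first by rewrite mulrBl; lra.
  apply: (@le_trans _ _ ((1 + eps) * (P * x))).
    by rewrite mulrCA ler_peMr// ltW.
  by rewrite ler_wpM2l// addr_ge0// ltW.
Qed.

End Growth.
End Spectrum.

Theorem theorem8 (R : realType)
    (mu : probability C3 R) (nu : probability (Upsilon R) R) (s : R)
    (mu_cantor : is_cantor_measure mu) (nu_product : is_product_measure mu nu) :
  (* (i) *)
  [/\ forall w, op_eigenvector (Delta mu nu s) (- lam s (wlen w)) (haar mu w),
      is_orthonormal_basis (haar mu) &
      forall a, op_eigenspace (Delta mu nu s) a =
        closed_span [set haar mu w | w in
          [set w | op_eigenvector (Delta mu nu s) a (haar mu w)]]] /\
  (* (ii) *)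
  (forall a, op_eigenvalue (Delta mu nu s) a <-> exists n, a = - lam s n) /\
  (* (iii) *)
  [/\ has_dim (op_eigenspace (Delta mu nu s) (- lam s 0)) 1,
      forall n, (1 <= n)%N ->
        has_dim (linear_span [set haar mu w | w in [set w | wlen w = n]])
          (2 ^ n.-1) &
      s <> 2 + 2 * s0 R -> forall n, (1 <= n)%N ->
        has_dim (op_eigenspace (Delta mu nu s) (- lam s n)) (2 ^ n.-1)] /\
  (* (iv) *)
  (s0 R + 2 < s ->
     bounded_op (Delta mu nu s) /\
     exists c : R, compact_op (op_sub_scalar (Delta mu nu s) c)) /\
  (* (v) *)
  (s <= s0 R + 2 -> compact_resolvent (Delta mu nu s)) /\
  (* (vi) *)
  (s < s0 R + 2 -> exists N : R -> nat,
     [/\ forall l, has_dim (spectral_space (Delta mu nu s) l) (N l),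
         (N l)%:R / dos_asymptotics s l
           @[l --> within [set `|a| | a in op_eigenvalue (Delta mu nu s)] +oo%R]
           --> (1 : R) &
         forall e : R, 0 < e -> \forall l \near +oo%R,
           (2^-1 - e) * dos_asymptotics s l <= (N l)%:R
             <= (1 + e) * dos_asymptotics s l]).
Proof.
have basis := haar_graded mu_cantor.
split; [split|split; [|split; [split|split; [|split]]]].
- by move=> w; rewrite Delta_diag//; apply/(diag_eigenvector_basis basis).
- exact: (basis_orthonormal basis).
- by move=> a; rewrite Delta_diag//; exact: (diag_eigenspace_span basis).
- by move=> a; exact: Delta_eigenvalueP.
- exact: dim_ground.
- by move=> n; exact: dim_haar_level.
- by move=> s2 n; exact: dim_eigenspace.
- exact: Delta_bounded_compact.
- exact: Delta_compact_resolvent.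
- exact: density_of_states.
Qed.
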